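(* Let $h,f:X\to\mathbb{R}$ be tame functions and suppose that $h(X)$ is discrete. Then $$\int_X (h+f)\,\lceil d\chi\rceil=\int_X h\,\lceil d\chi\rceil+\int_X f\,\lceil d\chi\rceil.$$
   Context: $\chi$ is the Euler characteristic (with $\chi(\emptyset)=0$). A continuous function $f:X\to\mathbb{R}$ on a compact topological space $X$ with finite Euler characteristic is tame if the homotopy types of $f^{-1}(-\infty,u]$ and $f^{-1}[u,\infty)$ change only finitely many times as $u$ varies over $\mathbb{R}$ and the Euler characteristic of each of these sets is finite. Write $\chi(f\le u)=\chi(f^{-1}(-\infty,u])$ and define $\chi(f>u):=\chi(X)-\chi(f\le u)$. The upper Euler integral is $\int_X f\,\lceil d\chi\rceil=\int_0^\infty[\chi(f>u)-\chi(f\le -u)]\,du$; the integral of $h+f$ is given by the same formula.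
   Formalization: It is additionally assumed that the integrand χ(h+f>u) − χ(h+f≤−u) is Borel measurable on [0,∞), so that the left-hand integral exists; tameness of h and f alone does not guarantee this. *)

(* Defs.v *)
From HB Require Import structures.
From mathcomp Require Import all_boot all_order all_algebra.
From mathcomp Require Import all_classical all_reals all_analysis.
From mathcomp Require Import freeg.

Set Implicit Arguments.
Unset Strict Implicit.
Unset Printing Implicit Defensive.

Import Order.TTheory GRing.Theory Num.Theory.
Import numFieldNormedType.Exports.

Local Open Scope classical_set_scope.
Local Open Scope ring_scope.

Definition homotopic (R : realType) (X Y : topologicalType) (f g : X -> Y) :=
  exists H : X * (`[0, 1]%classic : set R) -> Y,
    [/\ continuous H,
        forall x t, set_val t = 0 -> H (x, t) = f x &
        forall x t, set_val t = 1 -> H (x, t) = g x].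

Definition homotopy_equivalent (R : realType) (X Y : topologicalType) :=
  exists (f : X -> Y) (g : Y -> X),
    [/\ continuous f, continuous g,
        homotopic R (g \o f) id & homotopic R (f \o g) id].

(** The Euler characteristic is the alternating sum of the Betti numbers of
    singular homology with rational coefficients. *)

Definition simplex (R : realType) (n : nat) : set 'rV[R]_n.+1 :=
  [set t | (forall j, 0 <= t 0 j) /\ \sum_j t 0 j = 1].
Arguments simplex : clear implicits.

Definition face_row (R : realType) (n : nat) (i : 'I_n.+2) (t : 'rV[R]_n.+1) :
    'rV[R]_n.+2 :=
  \row_j (if unlift i j is Some k then t 0 k else 0).

Lemma face_row_simplex (R : realType) (n : nat) (i : 'I_n.+2)
    (t : simplex R n) : face_row i (set_val t) \in simplex R n.+1.
Proof.
have /set_mem[t_ge0 t_sum] := valP t; apply/mem_set; split => [j|].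
  by rewrite mxE; case: unliftP => [k|].
rewrite (bigD1_ord i) //= mxE unlift_none add0r -[RHS]t_sum.
by apply: eq_bigr => j _; rewrite mxE liftK.
Qed.

Definition face (R : realType) (n : nat) (i : 'I_n.+2) (t : simplex R n) :
    simplex R n.+1 :=
  exist _ (face_row i (set_val t)) (face_row_simplex i t).

Lemma continuous_face_row (R : realType) (n : nat) (i : 'I_n.+2) :
  continuous (@face_row R n i).
Proof.
move=> t A [P Pnbhs PA].
have PN j : nbhs t [set s : 'rV[R]_n.+1 | P ord0 j (face_row i s ord0 j)].
  have := Pnbhs ord0 j; rewrite /face_row mxE.
  case: (unliftP i j) => [k ->|->] Pj; last first.
    by apply: filterE => s /=; rewrite mxE unlift_none; exact: nbhs_singleton.
  have tP := @coord_continuous R _ _ ord0 k t _ Pj.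
  by apply: (@filterS _ (nbhs t) _ _ _ _ tP) => s /=; rewrite mxE liftK.
have tPN : nbhs t (fun s => forall j, P ord0 j (face_row i s ord0 j)).
  exact: filter_forall PN.
apply: (@filterS _ (nbhs t) _ _ _ _ tPN) => s Ps.
apply: PA => k j.
by rewrite (ord1 k); exact: Ps.
Qed.

Lemma continuous_face (R : realType) (n : nat) (i : 'I_n.+2) :
  continuous (@face R n i).
Proof.
apply: continuous_comp_initial => t.
apply: (@continuous_comp _ _ _ set_val (face_row i)).
  exact: initial_continuous.
exact: continuous_face_row.
Qed.

HB.instance Definition _ (R : realType) (n : nat) (i : 'I_n.+2) :=
  isContinuous.Build _ _ (@face R n i) (@continuous_face R n i).

Definition singular (R : realType) (X : topologicalType) (n : nat) :=
  continuousType (simplex R n) X.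

Definition chain (R : realType) (X : topologicalType) (n : nat) :=
  {freeg (singular R X n) / rat}.

Definition boundary (R : realType) (X : topologicalType) (n : nat) :
    chain R X n.+1 -> chain R X n :=
  fglift (fun s : singular R X n.+1 =>
    \sum_(i < n.+2) (-1) ^+ i *: << (s \o face i : singular R X n) >>).

Definition cycle (R : realType) (X : topologicalType) (n : nat) :
    chain R X n -> Prop :=
  if n is m.+1 then fun c : chain R X m.+1 => boundary c = 0 else fun=> True.

(** [betti_is R X n d]: [H_n(X; rat)] has a basis of [d] elements, the classes of
    the cycles [z i]. *)
Definition betti_is (R : realType) (X : topologicalType) (n d : nat) :=
  exists z : 'I_d -> chain R X n,
    (forall i, cycle (z i)) /\
    forall c, cycle c ->
      exists! a : 'rV[rat]_d,
        exists b, c - \sum_i a 0 i *: z i = boundary b.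

Definition betti (R : realType) (X : topologicalType) (n : nat) : nat :=
  xget 0%N [set d | betti_is R X n d].

Definition finite_euler (R : realType) (X : topologicalType) :=
  (forall n, exists d, betti_is R X n d) /\
  exists N, forall n, (N <= n)%N -> betti_is R X n 0.

(** Only meaningful under [finite_euler]: the sum is [0] when infinitely many
    terms are nonzero. *)
Definition euler (R : realType) (X : topologicalType) : int :=
  \sum_(n \in [set: nat]) (-1) ^+ n * (betti R X n)%:Z.

Section upper_euler_integral.
Context {R : realType} {X : topologicalType}.
Implicit Types (f : X -> R) (u : R).

Definition sublevel f u : set X := f @^-1` [set y | y <= u].

Definition superlevel f u : set X := f @^-1` [set y | u <= y].

(** The finite sequence [s] contains the values of [u] at which the homotopy
    type of [A u] may differ from that for nearby values, on either side. *)
Definition homotopy_type_changes_finitely (A : R -> set X) :=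
  exists s : seq R, forall u v, u <= v ->
    (forall w, w \in s -> ~~ (u <= w <= v)) ->
    homotopy_equivalent R (A u) (A v).

Definition tame f :=
  [/\ continuous f,
      homotopy_type_changes_finitely (sublevel f),
      homotopy_type_changes_finitely (superlevel f) &
      forall u, finite_euler R (sublevel f u) /\
                finite_euler R (superlevel f u)].

Definition euler_le f u : int := euler R (sublevel f u).

Definition euler_gt f u : int := euler R X - euler_le f u.

Definition upper_euler_integrand f u : R :=
  (euler_gt f u - euler_le f (- u))%:~R.

Definition upper_euler_integral f : \bar R :=
  (\int[lebesgue_measure]_(u in `[0%R, +oo[) (upper_euler_integrand f u)%:E)%E.

End upper_euler_integral.

(* Main.v *)
Require Import Defs.
From HB Require Import structures.
From mathcomp Require Import all_boot all_order all_algebra.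
From mathcomp Require Import all_classical all_reals all_analysis measurable_realfun.
From mathcomp Require Import freeg.
From mathcomp Require Import lra ring zify.

Set Implicit Arguments.
Unset Strict Implicit.
Unset Printing Implicit Defensive.

Import Order.TTheory GRing.Theory Num.Theory.
Import numFieldNormedType.Exports.

Local Open Scope classical_set_scope.
Local Open Scope ring_scope.

(** Since [X] is compact and [h(X)] is discrete, [h] has finitely many levels [c],
    with clopen fibers.  The Euler characteristic is additive over clopen
    partitions, so with [e c u = chi(f <= u, h = c)] we have
    [chi(f <= u) = sum_c e c u] and [chi(h + f <= u) = sum_c e c (u - c)].
    Subtracting a step function from [e c] leaves a bounded function [g c] with
    bounded support, and the integrand of [h + f] minus those of [h] and [f] is,
    away from [0], minus the sum over [c] of the translation coboundary
    [g c (u - c) - g c u] and of its reflection.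

    It remains to see that such a sum integrates to [0].  Only the sum of the
    [e c] has a homotopy type that changes finitely often, so the individual
    [g c] need not be measurable, and the coboundaries cannot be integrated
    separately.  Instead, one averages the sum over [N] translations by [c]: this
    preserves its integral and replaces the coboundary of [g c] by a function
    bounded by [2 / N] times a dominating function, up to a translation.  Treating
    the [c] one after the other shows that the integral is arbitrarily small.

    Homotopy invariance of singular homology (by the prism operator) makes
    [chi(f <= u)] constant between finitely many values of [u], hence measurable,
    and bounds the [e c] by the total Betti number of [f <= u]. *)

(** * Dimensions of subquotients *)

Section subquotient_dimension.
Variable F : fieldType.

Definition subspace_pred (V : lmodType F) (P : V -> Prop) :=
  P 0 /\ forall a x y, P x -> P y -> P (a *: x + y).

Lemma subspace_pred_sub (V : lmodType F) (P : V -> Prop) x y :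
  subspace_pred P -> P x -> P y -> P (x - y).
Proof. by move=> [_ PD] Px Py; rewrite addrC -scaleN1r; exact: PD. Qed.

Lemma subspace_pred_sum (V : lmodType F) (P : V -> Prop) d
    (a : 'I_d -> F) (z : 'I_d -> V) :
  subspace_pred P -> (forall i, P (z i)) -> P (\sum_i a i *: z i).
Proof.
move=> [P0 PD] Pz; elim/big_ind: _ => // [x y Px Py|i _].
  by rewrite -[x]scale1r; exact: PD.
by rewrite -[_ *: _]addr0; exact: PD.
Qed.

(** Phrased like [betti_is], so that Betti numbers are an instance by conversion. No quotient space
    is formed. *)
Definition subquotient_dim (V : lmodType F) (Z B : V -> Prop) (d : nat) :=
  exists z : 'I_d -> V, (forall i, Z (z i)) /\
    forall c, Z c -> exists! a : 'rV[F]_d, B (c - \sum_i a 0 i *: z i).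

(** The coordinate isomorphism of [Z / B], lifted to a plain function on [V] that is constrained
    only on [Z]. *)
Definition subquotient_coord (V : lmodType F) (Z B : V -> Prop) (d : nat)
    (pi : V -> 'rV[F]_d) :=
  [/\ forall a x y, Z x -> Z y -> pi (a *: x + y) = a *: pi x + pi y,
      forall x, Z x -> (pi x = 0 <-> B x) &
      forall v, exists2 x, Z x & pi x = v].

Lemma subquotient_coord_sum (V : lmodType F) (Z B : V -> Prop) d
    (pi : V -> 'rV[F]_d) k (a : 'I_k -> F) (z : 'I_k -> V) :
  subspace_pred Z -> subquotient_coord Z B pi -> (forall i, Z (z i)) ->
  pi (\sum_i a i *: z i) = \sum_i a i *: pi (z i).
Proof.
move=> Zs [piD piB _] Zz.
have pi0 : pi 0 = 0.
  by have := piD (- 1) 0 0 Zs.1 Zs.1; rewrite scaleN1r addr0 oppr0 scaleN1r addNr.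
suff: Z (\sum_i a i *: z i) /\ pi (\sum_i a i *: z i) = \sum_i a i *: pi (z i).
  by case.
elim/big_rec2: _ => [|i y1 y2 _ [Zy <-]]; first by split=> //; exact: Zs.1.
by split; [exact: Zs.2 | exact: piD].
Qed.

Lemma subquotient_dimP (V : lmodType F) (Z B : V -> Prop) d :
  subspace_pred Z -> subspace_pred B ->
  subquotient_dim Z B d <-> exists pi, subquotient_coord Z B (d := d) pi.
Proof.
move=> Zs Bs; split=> [[z [Zz zP]]|[pi piP]].
  have /choice[pi piP] : forall c, exists a : 'rV[F]_d,
      Z c -> B (c - \sum_i a 0 i *: z i).
    move=> c; have [/zP[a [aP _]]|nZ] := pselect (Z c); first by exists a.
    (* Default value outside [Z]. *)
    by exists 0.
  have piE c (a : 'rV_d) : Z c -> B (c - \sum_i a 0 i *: z i) -> pi c = a.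
    move=> Zc Bca; have [b [_ bU]] := zP c Zc.
    by rewrite -(bU _ Bca) -(bU _ (piP c Zc)).
  exists pi; split.
  - move=> a x y Zx Zy; apply: piE; first exact: Zs.2.
    have := Bs.2 a _ _ (piP x Zx) (piP y Zy); congr B.
    rewrite scalerBr scaler_sumr addrACA -opprD -big_split/=.
    by congr (_ - _); apply: eq_bigr => i _; rewrite !mxE scalerDl scalerA.
  - move=> x Zx; split=> [pix0|Bx].
      have := piP x Zx; rewrite pix0 big1 ?subr0// => i _.
      by rewrite mxE scale0r.
    apply: piE => //; rewrite big1 ?subr0// => i _.
    by rewrite mxE scale0r.
  - move=> v; have Zv := subspace_pred_sum (v 0) Zs Zz.
    exists (\sum_i v 0 i *: z i) => //; apply: piE => //.
    by rewrite subrr; exact: Bs.1.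
have [piD piB piS] := piP.
have /choice[z zP] : forall i : 'I_d, exists x, Z x /\ pi x = delta_mx 0 i.
  by move=> i; have [x Zx xi] := piS (delta_mx 0 i); exists x.
have Zz i := (zP i).1.
exists z; split=> // c Zc.
have key (a : 'rV_d) : B (c - \sum_i a 0 i *: z i) <-> pi c = a.
  have Za := subspace_pred_sum (a 0) Zs Zz.
  rewrite -piB; last exact: subspace_pred_sub.
  rewrite addrC -scaleN1r piD// (subquotient_coord_sum _ Zs piP)//.
  rewrite (eq_bigr (fun i => a 0 i *: delta_mx 0 i)); last first.
    by move=> i _; rewrite (zP i).2.
  rewrite -row_sum_delta scaleN1r addrC; split=> [/eqP|->]; last exact: subrr.
  by rewrite subr_eq0 => /eqP.
by exists (pi c); split=> [|a /key//]; apply/key.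
Qed.

(** The rows of [M] are the [rho]-coordinates of lifts of the basis attached to [pi]. A vector of
    the left kernel of [M] combines these lifts into an element of [B], so it is zero, and the rank
    of [M] is [d]. *)
Lemma subquotient_coord_le (V : lmodType F) (Z B : V -> Prop) d e
    (pi : V -> 'rV[F]_d) (rho : V -> 'rV[F]_e) : subspace_pred Z ->
  subquotient_coord Z B pi -> subquotient_coord Z B rho -> (d <= e)%N.
Proof.
move=> Zs piP rhoP; have [piD piB piS] := piP; have [rhoD rhoB rhoS] := rhoP.
have /choice[z zP] : forall i : 'I_d, exists x, Z x /\ pi x = delta_mx 0 i.
  by move=> i; have [x Zx xi] := piS (delta_mx 0 i); exists x.
have Zz i := (zP i).1.
pose M := \matrix_i rho (z i).
have Mv (v : 'rV_d) : v *m M = rho (\sum_i v 0 i *: z i).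
  rewrite (subquotient_coord_sum _ Zs rhoP)// mulmx_sum_row.
  by apply: eq_bigr => i _; rewrite rowK.
suff: row_free M by rewrite -row_leq_rank => /leq_trans; apply; exact: rank_leq_col.
rewrite -kermx_eq0; apply/eqP/row_matrixP => i; rewrite row0.
have : row i (kermx M) *m M = 0 by apply/sub_kermxP; exact: row_sub.
set v := row i _; rewrite Mv.
have Zv := subspace_pred_sum (v 0) Zs Zz.
rewrite rhoB// -piB// (subquotient_coord_sum _ Zs piP)//.
rewrite (eq_bigr (fun i => v 0 i *: delta_mx 0 i)); last first.
  by move=> j _; rewrite (zP j).2.
by rewrite -row_sum_delta.
Qed.

Lemma subquotient_dim_unique (V : lmodType F) (Z B : V -> Prop) d e :
  subspace_pred Z -> subspace_pred B ->
  subquotient_dim Z B d -> subquotient_dim Z B e -> d = e.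
Proof.
move=> Zs Bs /(subquotient_dimP _ Zs Bs)[pi piP].
move=> /(subquotient_dimP _ Zs Bs)[rho rhoP].
apply/eqP; rewrite eqn_leq.
by rewrite (subquotient_coord_le Zs piP rhoP) (subquotient_coord_le Zs rhoP piP).
Qed.

(** [phi] and [psi] are mutually inverse modulo [B] and [B']. The coordinates on [W] are those of
    [V] composed with [psi], which is therefore the map taken linear. *)
Lemma subquotient_dim_transport (V W : lmodType F) (Z B : V -> Prop)
    (Z' B' : W -> Prop) d (phi : V -> W) (psi : {linear W -> V}) :
  subspace_pred Z -> subspace_pred B -> subspace_pred Z' -> subspace_pred B' ->
  (forall x, Z x -> Z' (phi x)) -> (forall x, B x -> B' (phi x)) ->
  (forall y, Z' y -> Z (psi y)) -> (forall y, B' y -> B (psi y)) ->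
  (forall x, Z x -> B (x - psi (phi x))) ->
  (forall y, Z' y -> B' (y - phi (psi y))) ->
  subquotient_dim Z B d -> subquotient_dim Z' B' d.
Proof.
move=> Zs Bs Zs' Bs' phiZ phiB psiZ psiB psiphi phipsi.
move=> /(subquotient_dimP _ Zs Bs)[pi [piD piB piS]].
apply/(subquotient_dimP _ Zs' Bs'); exists (pi \o psi); split.
- by move=> a x y Zx Zy /=; rewrite linearP piD//; exact: psiZ.
- move=> y Zy /=; rewrite piB; last exact: psiZ.
  split=> [By|]; last exact: psiB.
  rewrite -(subrK (phi (psi y)) y) -[X in X + _]scale1r.
  by apply: Bs'.2; [exact: phipsi | exact: phiB].
- move=> v; have [x Zx <-] := piS v; exists (phi x); first exact: phiZ.
  have Zp : Z (psi (phi x)) by exact/psiZ/phiZ.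
  have /(piB _ (subspace_pred_sub Zs Zx Zp)) := psiphi x Zx.
  rewrite addrC -scaleN1r piD// scaleN1r addrC => /eqP.
  by rewrite subr_eq0 => /eqP.
Qed.

(** The endomorphism that [i \o p] induces on [Z / B] has matrix [E], and its image is a copy of
    [Z' / B']. Coordinates on it are taken in the basis [row_base E] of the row space. *)
Lemma subquotient_dim_retract (V W : lmodType F) (Z B : V -> Prop)
    (Z' B' : W -> Prop) d (pi : V -> 'rV[F]_d) (E : 'M[F]_d)
    (i : {linear W -> V}) (p : V -> W) :
  subspace_pred Z' -> subspace_pred B' ->
  (forall y, Z' y -> Z (i y)) -> (forall y, B' y -> B (i y)) ->
  (forall x, Z x -> Z' (p x)) -> (forall x, B x -> B' (p x)) ->
  cancel i p ->
  subquotient_coord Z B pi -> (forall x, Z x -> pi (i (p x)) = pi x *m E) ->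
  subquotient_dim Z' B' (\rank E).
Proof.
move=> Zs' Bs' iZ iB pZ pB iK [piD piB piS] piE.
apply/(subquotient_dimP _ Zs' Bs').
(* Since [y = p (i y)], the matrix [E] fixes the coordinates of [i y]. *)
have subE y : Z' y -> (pi (i y) <= row_base E)%MS.
  move=> Zy; rewrite eq_row_base -{1}(iK y) piE ?submxMl//; exact: iZ.
exists (fun y => pi (i y) *m pinvmx (row_base E)); split.
- move=> a x y Zx Zy; rewrite linearP piD; [|exact: iZ..].
  by rewrite mulmxDl scalemxAl.
- move=> y Zy; split=> [y0|By].
    have : pi (i y) = 0 by rewrite -(mulmxKpV (subE y Zy)) y0 mul0mx.
    by move/(piB _ (iZ _ Zy))/pB; rewrite iK.
  by rewrite (piB _ (iZ _ Zy)).2 ?mul0mx//; exact: iB.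
- move=> v.
  have /submxP[w wE] : (v *m row_base E <= E)%MS by rewrite mulmx_sub// eq_row_base.
  have [x Zx xw] := piS w; exists (p x); first exact: pZ.
  by rewrite piE// xw -wE mulmxKp// row_base_free.
Qed.

(** Finite dimension of the summands is part of the conclusion. The projectors [i1 \o p1] and
    [i2 \o p2] induce complementary projectors [M1] and [M2] of the coordinate space of [Z / B], and
    the two dimensions are their ranks. *)
Lemma subquotient_dim_split (V W1 W2 : lmodType F) (Z B : V -> Prop)
    (Z1 B1 : W1 -> Prop) (Z2 B2 : W2 -> Prop) d
    (i1 : {linear W1 -> V}) (p1 : {linear V -> W1})
    (i2 : {linear W2 -> V}) (p2 : {linear V -> W2}) :
  subspace_pred Z -> subspace_pred B ->
  subspace_pred Z1 -> subspace_pred B1 -> subspace_pred Z2 -> subspace_pred B2 ->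
  (forall y, Z1 y -> Z (i1 y)) -> (forall y, B1 y -> B (i1 y)) ->
  (forall x, Z x -> Z1 (p1 x)) -> (forall x, B x -> B1 (p1 x)) ->
  (forall y, Z2 y -> Z (i2 y)) -> (forall y, B2 y -> B (i2 y)) ->
  (forall x, Z x -> Z2 (p2 x)) -> (forall x, B x -> B2 (p2 x)) ->
  cancel i1 p1 -> cancel i2 p2 -> (forall x, i1 (p1 x) + i2 (p2 x) = x) ->
  subquotient_dim Z B d ->
  exists d1 d2, [/\ subquotient_dim Z1 B1 d1, subquotient_dim Z2 B2 d2 &
    d = (d1 + d2)%N].
Proof.
move=> Zs Bs Z1s B1s Z2s B2s i1Z i1B p1Z p1B i2Z i2B p2Z p2B.
move=> i1K i2K ipD /(subquotient_dimP _ Zs Bs)[pi piP].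
have [piD piB piS] := piP.
have /choice[z zP] : forall i : 'I_d, exists x, Z x /\ pi x = delta_mx 0 i.
  by move=> i; have [x Zx xi] := piS (delta_mx 0 i); exists x.
have Zz i := (zP i).1.
have pi_eq x y : Z x -> Z y -> pi x = pi y -> B (x - y).
  move=> Zx Zy xy; apply/piB; first exact: subspace_pred_sub.
  by rewrite addrC -scaleN1r piD// xy scaleN1r addNr.
(* Whichever summand is chosen, its projector preserves [Z] and [B], hence acts on coordinates by
   the matrix of its values on the lifted basis [z]. *)
have matE (W : lmodType F) (ZW BW : W -> Prop)
    (i : {linear W -> V}) (p : {linear V -> W}) :
    (forall y, ZW y -> Z (i y)) -> (forall y, BW y -> B (i y)) ->
    (forall x, Z x -> ZW (p x)) -> (forall x, B x -> BW (p x)) ->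
    forall x, Z x -> pi (i (p x)) = pi x *m \matrix_j pi (i (p (z j))).
  move=> iZ iB pZ pB x Zx.
  have Zv := subspace_pred_sum (pi x 0) Zs Zz.
  have xv : pi x = pi (\sum_j pi x 0 j *: z j).
    rewrite (subquotient_coord_sum _ Zs piP)// {1}[pi x]row_sum_delta.
    by apply: eq_bigr => j _; rewrite (zP j).2.
  rewrite mulmx_sum_row.
  under eq_bigr do rewrite rowK.
  rewrite -(subquotient_coord_sum _ Zs piP); last by move=> j; exact/iZ/pZ.
  have -> : \sum_j pi x 0 j *: i (p (z j)) = i (p (\sum_j pi x 0 j *: z j)).
    by rewrite !linear_sum; apply: eq_bigr => j _; rewrite !linearZ.
  have Zip u : Z u -> Z (i (p u)) by move=> Zu; exact/iZ/pZ.
  have : B (i (p (x - \sum_j pi x 0 j *: z j))) by apply/iB/pB/pi_eq.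
  rewrite !linearB/= -piB; last by apply: subspace_pred_sub => //; exact: Zip.
  rewrite addrC -scaleN1r piD; [|exact: Zip..].
  by rewrite scaleN1r addrC => /eqP; rewrite subr_eq0 => /eqP.
pose M1 := \matrix_j pi (i1 (p1 (z j))); pose M2 := \matrix_j pi (i2 (p2 (z j))).
have E1 : forall x, Z x -> _ = _ *m M1 := matE _ _ _ _ _ i1Z i1B p1Z p1B.
have E2 : forall x, Z x -> _ = _ *m M2 := matE _ _ _ _ _ i2Z i2B p2Z p2B.
exists (\rank M1), (\rank M2); split.
- exact: (subquotient_dim_retract Z1s B1s i1Z i1B p1Z p1B i1K piP).
- exact: (subquotient_dim_retract Z2s B2s i2Z i2B p2Z p2B i2K piP).
have M12 : M1 + M2 = 1%:M.
  apply/row_matrixP => j; rewrite linearD/= !rowK rowE mulmx1.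
  rewrite -[RHS](zP j).2 -[in RHS](ipD (z j)) -[i1 _ in RHS]scale1r piD; last 2 first.
  - exact/i1Z/p1Z.
  - exact/i2Z/p2Z.
  by rewrite scale1r.
have M1M : M1 *m M1 = M1.
  apply/row_matrixP => j; rewrite row_mul !rowK -E1; last exact/i1Z/p1Z.
  by rewrite i1K.
have M0 : M1 *m M2 = 0.
  by apply: (@addrI _ M1); rewrite -{1}M1M -mulmxDr M12 mulmx1 addr0.
(* [M1 + M2 = 1] bounds [d] by the sum of the ranks, and [M1 *m M2 = 0] bounds the sum by [d]. *)
apply/eqP; rewrite eqn_leq; apply/andP; split; last exact: mulmx0_rank_max.
by rewrite -{1}(mxrank1 F d) -M12 mxrank_add.
Qed.

(** The coordinates of the two summands are concatenated. *)
Lemma subquotient_dim_join (V W1 W2 : lmodType F) (Z B : V -> Prop)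
    (Z1 B1 : W1 -> Prop) (Z2 B2 : W2 -> Prop) d1 d2
    (i1 : {linear W1 -> V}) (p1 : {linear V -> W1})
    (i2 : {linear W2 -> V}) (p2 : {linear V -> W2}) :
  subspace_pred Z -> subspace_pred B ->
  subspace_pred Z1 -> subspace_pred B1 -> subspace_pred Z2 -> subspace_pred B2 ->
  (forall y, Z1 y -> Z (i1 y)) -> (forall y, B1 y -> B (i1 y)) ->
  (forall x, Z x -> Z1 (p1 x)) -> (forall x, B x -> B1 (p1 x)) ->
  (forall y, Z2 y -> Z (i2 y)) -> (forall y, B2 y -> B (i2 y)) ->
  (forall x, Z x -> Z2 (p2 x)) -> (forall x, B x -> B2 (p2 x)) ->
  cancel i1 p1 -> cancel i2 p2 -> (forall x, i1 (p1 x) + i2 (p2 x) = x) ->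
  subquotient_dim Z1 B1 d1 -> subquotient_dim Z2 B2 d2 ->
  subquotient_dim Z B (d1 + d2).
Proof.
move=> Zs Bs Z1s B1s Z2s B2s i1Z i1B p1Z p1B i2Z i2B p2Z p2B i1K i2K ipD.
move=> /(subquotient_dimP _ Z1s B1s)[pi1 [pi1D pi1B pi1S]].
move=> /(subquotient_dimP _ Z2s B2s)[pi2 [pi2D pi2B pi2S]].
(* Applying [ipD] to [i2 y] leaves [i1 (p1 (i2 y)) = 0], and [i1] is injective. *)
have p1i2 y : p1 (i2 y) = 0.
  have /eqP := ipD (i2 y); rewrite i2K -subr_eq0 addrK => /eqP E.
  by rewrite -(i1K (p1 (i2 y))) E linear0.
have p2i1 y : p2 (i1 y) = 0.
  have /eqP := ipD (i1 y); rewrite i1K addrC -subr_eq0 addrK => /eqP E.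
  by rewrite -(i2K (p2 (i1 y))) E linear0.
apply/(subquotient_dimP _ Zs Bs).
exists (fun x => row_mx (pi1 (p1 x)) (pi2 (p2 x))); split.
- move=> a x y Zx Zy; rewrite !linearP pi1D ?pi2D; try by [exact: p1Z | exact: p2Z].
  by rewrite scale_row_mx add_row_mx.
- move=> x Zx; split=> [/eqP|Bx].
    rewrite row_mx_eq0 => /andP[/eqP/(pi1B _ (p1Z _ Zx)) Bp1].
    move=> /eqP/(pi2B _ (p2Z _ Zx)) Bp2.
    by rewrite -(ipD x) -[i1 _]scale1r; apply: Bs.2; [exact: i1B | exact: i2B].
  by rewrite (pi1B _ (p1Z _ Zx)).2 ?(pi2B _ (p2Z _ Zx)).2 ?row_mx0//;
    [exact: p2B | exact: p1B].
- move=> v; have [x1 Zx1 x1v] := pi1S (lsubmx v); have [x2 Zx2 x2v] := pi2S (rsubmx v).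
  exists (i1 x1 + i2 x2).
    by rewrite -[i1 _]scale1r; apply: Zs.2; [exact: i1Z | exact: i2Z].
  by rewrite !linearD/= i1K i2K p1i2 p2i1 addr0 add0r x1v x2v hsubmxK.
Qed.

End subquotient_dimension.

(** * Homotopy invariance of singular homology *)

Section freeg_linear.
Variables (K : nzRingType) (T : choiceType).

Lemma fglift_is_linear (M : lmodType K) (f : T -> M) : linear (fglift f).
Proof.
have fB : {morph fglift f : x y / x - y} by exact: lift_is_additive.
have f0 : fglift f 0 = 0 by rewrite -(subrr 0) fB subrr.
have fD : {morph fglift f : x y / x + y}.
  by move=> x y; rewrite -[y in LHS]opprK -[- y]sub0r !fB f0 sub0r opprK.
have fZ a x : fglift f (a *: x) = a *: fglift f x.
  rewrite -[x in LHS]freeg_sumE -[x in RHS]freeg_sumE.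
  elim: (dom x) => [|t s IH]; first by rewrite !big_nil scaler0 f0 scaler0.
  rewrite !big_cons scalerDr !fD IH scalerDr; congr (_ + _).
  have -> : a *: << coeff t x *g t >> = << a * coeff t x *g t >>.
    by apply/eqP/freeg_eqP => u; rewrite coeffZ !coeffU mulrA.
  by rewrite !liftU scalerA.
by move=> a x y; rewrite fD fZ.
Qed.

HB.instance Definition _ (M : lmodType K) (f : T -> M) :=
  GRing.isLinear.Build K {freeg T / K} M *:%R (fglift f) (fglift_is_linear f).

Lemma fgliftU (M : lmodType K) (f : T -> M) x : fglift f << x >> = f x.
Proof. by rewrite liftU scale1r. Qed.

Lemma freeg_linear_ext (M : lmodType K) (f g : {linear {freeg T / K} -> M}) :
  (forall x, f << x >> = g << x >>) -> f =1 g.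
Proof.
move=> fg x; rewrite -[x]freeg_sumE !linear_sum; apply: eq_bigr => t _.
have -> : << coeff t x *g t >> = coeff t x *: << t >> :> {freeg T / K}.
  by apply/eqP/freeg_eqP => u; rewrite coeffZ !coeffU mul1r.
by rewrite !linearZ fg.
Qed.

End freeg_linear.

(* [A i j] is the [j]-th face of the [i]-th simplex of a prism over an
   [n]-simplex, [B i j] the [i]-th simplex of the prism over its [j]-th face, and
   [C] lists the slices between the top and the bottom of the prism. *)
Lemma alternating_prism_sum (V : lmodType rat) n (A B : nat -> nat -> V)
    (C : nat -> V) :
  (forall i j, (j < i <= n)%N -> A i j = B i.-1 j) ->
  (forall i j, (i.+1 < j <= n.+1)%N -> A i j = B i j.-1) ->
  (forall i, (i <= n)%N -> A i i = C i) ->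
  (forall i, (i <= n)%N -> A i i.+1 = C i.+1) ->
  \sum_(0 <= i < n.+1) \sum_(0 <= j < n.+2) (-1) ^+ (i + j) *: A i j =
  C 0%N - C n.+1 -
    \sum_(0 <= i < n) \sum_(0 <= j < n.+1) (-1) ^+ (i + j) *: B i j.
Proof.
move=> AB1 AB2 AC1 AC2.
(* Row [i] is cut into the faces below [i], the two faces [i] and [i + 1], which have opposite
   signs, and the faces above. *)
transitivity (\sum_(0 <= i < n.+1) (\sum_(0 <= j < i) (-1) ^+ (i + j) *: B i.-1 j
   + (C i - C i.+1) + \sum_(i.+1 <= j < n.+1) (-1) ^+ (i + j.+1) *: B i j)).
  apply: eq_big_nat => i /= /[dup] ilt.
  rewrite ltnS => ile.
  rewrite (@big_cat_nat _ _ _ i)//=; last by rewrite ltnW// ltnW.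
  rewrite -addrA; congr (_ + _).
    by apply: eq_big_nat => j /= ji; rewrite AB1// ji.
  rewrite big_ltn; last by rewrite ltnW.
  rewrite big_ltn ?ltnS// AC1// AC2// addnS addnn exprS -signr_odd odd_double.
  rewrite expr0 mulr1 scale1r scaleN1r addrA; congr (_ + _).
  rewrite big_add1; apply: eq_big_nat => j /andP[ij jn]; rewrite AB2 ?ltnS ?ij//.
(* The middle terms telescope. The two outer parts, reindexed, form the double sum of [B] with the
   opposite sign. *)
rewrite !big_split/= addrAC addrC; congr (_ + _).
  rewrite -[RHS]opprB -(telescope_sumr C)// -sumrN.
  by rewrite -big_split/=; apply: eq_bigr => i _; rewrite opprB.
rewrite big_nat_recl// big_geq// add0r.
rewrite [X in _ + X]big_nat_recr//= [X in _ + (_ + X)]big_geq// addr0.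
rewrite -big_split -sumrN/=; apply: eq_big_nat => i /= ilt.
rewrite [in RHS](@big_cat_nat _ _ _ i.+1)//=; last exact: ltnW.
rewrite opprD -!sumrN; congr (_ + _); apply: eq_bigr => j _.
  by rewrite addSn exprS mulN1r scaleNr.
by rewrite addnS exprS mulN1r scaleNr.
Qed.

(** * Faces and degeneracies of the standard simplex *)

Section simplices.
Variable R : realType.

Lemma eq_continuous (T U : topologicalType) (f g : T -> U) :
  f =1 g -> continuous f -> continuous g.
Proof. by move=> /funext ->. Qed.

Lemma comp_continuous (T U W : topologicalType) (f : T -> U) (g : U -> W) :
  continuous f -> continuous g -> continuous (g \o f).
Proof. by move=> cf cg t; apply: continuous_comp; [exact: cf | exact: cg]. Qed.

Lemma pair_continuous (T U W : topologicalType) (f : T -> U) (g : T -> W) :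
  continuous f -> continuous g -> continuous (fun t => (f t, g t)).
Proof. by move=> cf cg t; apply: cvg_pair; [exact: cf | exact: cg]. Qed.

Lemma addf_continuous (T : topologicalType) (f g : T -> R) :
  continuous f -> continuous g -> continuous (fun t => f t + g t).
Proof. by move=> cf cg t; apply: cvgD; [exact: cf | exact: cg]. Qed.

Lemma row_continuous (T : topologicalType) n (f : T -> 'rV[R]_n) :
  (forall j, continuous (fun t => f t 0 j)) -> continuous f.
Proof.
move=> cf t A [P Pnbhs PA].
have PN j : nbhs t [set s | P ord0 j (f s ord0 j)] by exact: cf (Pnbhs ord0 j).
have tPN : nbhs t (fun s => forall j, P ord0 j (f s ord0 j)).
  exact: filter_forall PN.
apply: (@filterS _ (nbhs t) _ _ _ _ tPN) => s Ps.
by apply: PA => k j; rewrite (ord1 k); exact: Ps.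
Qed.

Lemma simplex_coord_continuous n (j : 'I_n.+1) :
  continuous (fun t : simplex R n => set_val t 0 j).
Proof.
move=> t; apply: (@continuous_comp _ _ _ set_val (fun s : 'rV[R]_n.+1 => s 0 j)).
  exact: initial_continuous.
exact: coord_continuous.
Qed.

(* The degeneracy that sends the vertices [i] and [i + 1] to [i]. *)
Definition degen_row n (i : nat) (t : 'rV[R]_n.+2) : 'rV[R]_n.+1 :=
  \row_(j < n.+1) ((if (j <= i)%N then t 0 (widen_ord (leqnSn _) j) else 0) +
                   (if (i <= j)%N then t 0 (fintype.lift ord0 j) else 0)).

(** The affine function with value 1 at the vertices [k >= i] and 0 at the others; it serves as the
    height in the prism. *)
Definition tail_weight n (i : nat) (t : 'rV[R]_n.+1) : R :=
  \sum_(k < n.+1 | (i <= k)%N) t 0 k.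

Lemma degen_row_simplex n (i : 'I_n.+1) (t : simplex R n.+1) :
  degen_row i (set_val t) \in simplex R n.
Proof.
have /set_mem[t_ge0 t_sum] := valP t; apply/mem_set; split => [j|].
  by rewrite mxE addr_ge0//; case: ifP.
rewrite -[RHS]t_sum.
under eq_bigr do rewrite mxE.
rewrite big_split/= -!big_mkcond/=.
rewrite [RHS](bigID (fun k : 'I_n.+2 => (k <= i)%N))/=; congr (_ + _).
  rewrite [RHS]big_mkcond [RHS]big_ord_recr/= leqNgt ltn_ord/= addr0 -big_mkcond.
  by apply: eq_bigr => j _; congr (_ _ _); exact: val_inj.
rewrite [RHS]big_mkcond [RHS]big_ord_recl/= add0r -big_mkcond/=.
by apply: eq_bigl => j; rewrite -ltnNge.
Qed.

Definition degen n (i : 'I_n.+1) (t : simplex R n.+1) : simplex R n :=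
  exist _ (degen_row i (set_val t)) (degen_row_simplex i t).

Lemma degen_continuous n (i : 'I_n.+1) : continuous (degen (n := n) i).
Proof.
apply: continuous_comp_initial; apply: row_continuous => j.
apply: (@eq_continuous _ _ (fun x : simplex R n.+1 =>
    (if (j <= i)%N then set_val x 0 (widen_ord (leqnSn _) j) else 0) +
    (if (i <= j)%N then set_val x 0 (fintype.lift ord0 j) else 0))).
  by move=> x; rewrite -[RHS]/(degen_row i (set_val x) 0 j) mxE.
by apply: addf_continuous; case: (_ <= _)%N;
   by [exact: simplex_coord_continuous | exact: cst_continuous].
Qed.

Lemma tail_weight_itv n i (t : simplex R n) :
  tail_weight i (set_val t) \in (`[0, 1]%classic : set R).
Proof.
have /set_mem[t_ge0 t_sum] := valP t; apply/mem_set.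
rewrite /= in_itv/= sumr_ge0//= -t_sum.
by rewrite [leRHS](bigID (fun k : 'I_n.+1 => (i <= k)%N))/= lerDl sumr_ge0.
Qed.

Definition tail n i (t : simplex R n) : (`[0, 1]%classic : set R) :=
  exist _ (tail_weight i (set_val t)) (tail_weight_itv i t).

Lemma tail_continuous n i : continuous (tail (n := n) i).
Proof.
apply: continuous_comp_initial.
rewrite (_ : _ \o _ =
  fun t : simplex R n => \sum_(k < n.+1 | (i <= k)%N) set_val t 0 k)//.
apply: continuous_big => [|k _]; last exact: simplex_coord_continuous.
by move=> [a b]; apply: cvgD; [exact: cvg_fst | exact: cvg_snd].
Qed.

(** Indexing coordinates by naturals through [inord] reduces the simplicial identities below to case
    distinctions on inequalities. *)
Lemma face_rowE n (j : 'I_n.+2) (t : 'rV[R]_n.+1) (k : nat) : (k <= n.+1)%N ->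
  face_row j t 0 (inord k) =
  if (k < j)%N then t 0 (inord k) else
  if (j < k)%N then t 0 (inord k.-1) else 0.
Proof.
move=> kn; rewrite mxE; case: unliftP => [l|] /(congr1 val); rewrite /= inordK//.
  rewrite /bump => ->; have ln := ltn_ord l.
  case: (leqP j l) => jl /=; last by rewrite add0n jl inord_val.
  by rewrite ltnNge (leq_trans jl)//= ltnS jl inord_val.
by move=> ->; rewrite ltnn.
Qed.

Lemma degen_rowE n i (t : 'rV[R]_n.+2) (k : nat) : (k <= n)%N ->
  degen_row i t 0 (inord k) =
  (if (k <= i)%N then t 0 (inord k) else 0) +
  (if (i <= k)%N then t 0 (inord k.+1) else 0).
Proof.
move=> kn; rewrite mxE inordK//.
by congr (_ + _); case: (_ <= _)%N => //; congr (t 0 _); apply: val_inj;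
  rewrite /= !inordK// ltnS// ltnW.
Qed.

Lemma rowP_inord n (s t : 'rV[R]_n.+1) :
  (forall k, (k <= n)%N -> s 0 (inord k) = t 0 (inord k)) -> s = t.
Proof. by move=> st; apply/rowP => k; rewrite -(inord_val k) st// -ltnS. Qed.

Ltac row_cases x :=
  repeat (case: ifP => ?); rewrite ?addr0 ?add0r//;
  try lia; try (congr (x 0 (inord _)); lia);
  try (congr (x 0 (inord _) + x 0 (inord _)); lia).

(** A simplicial identity. The shifted indices [i'] and [j'] are given by equations between
    naturals, which avoids casts of ordinals. *)
Lemma degen_face_lt n (i : 'I_n.+2) (j : 'I_n.+3) (i' : 'I_n.+1) (j' : 'I_n.+2)
    (t : simplex R n.+1) :
  (j < i)%N -> i' = i.-1 :> nat -> j' = j :> nat ->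
  degen i (face j t) = face j' (degen i' t).
Proof.
move=> ji ii' jj'; apply: val_inj; apply/rowP_inord => k kn.
rewrite -[LHS]/(degen_row i (face_row j (set_val t)) 0 _).
rewrite -[RHS]/(face_row j' (degen_row i' (set_val t)) 0 _).
move: (set_val t) => {}t; have iin := ltn_ord i.
rewrite degen_rowE// [RHS]face_rowE//.
case: (ltngtP k j') => kj; rewrite ?degen_rowE ?ii'; try lia.
all: rewrite !face_rowE; try lia.
all: row_cases t.
Qed.

Lemma degen_face_gt n (i : 'I_n.+2) (j : 'I_n.+3) (i' : 'I_n.+1) (j' : 'I_n.+2)
    (t : simplex R n.+1) :
  (i.+1 < j)%N -> i' = i :> nat -> j' = j.-1 :> nat ->
  degen i (face j t) = face j' (degen i' t).
Proof.
move=> ji ii' jj'; apply: val_inj; apply/rowP_inord => k kn.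
rewrite -[LHS]/(degen_row i (face_row j (set_val t)) 0 _).
rewrite -[RHS]/(face_row j' (degen_row i' (set_val t)) 0 _).
move: (set_val t) => {}t; have jn := ltn_ord j.
rewrite degen_rowE// [RHS]face_rowE//.
case: (ltngtP k j') => kj; rewrite ?degen_rowE ?ii'; try lia.
all: rewrite !face_rowE; try lia.
all: row_cases t.
Qed.

Lemma degen_face_id n (i : 'I_n.+1) (j : 'I_n.+2) (t : simplex R n) :
  (i <= j <= i.+1)%N -> degen i (face j t) = t.
Proof.
move=> ij; apply: val_inj; apply/rowP_inord => k kn.
rewrite -[LHS]/(degen_row i (face_row j (set_val t)) 0 _).
rewrite -[RHS]/(set_val t 0 _).
move: (set_val t) => {}t; have iin := ltn_ord i; have jn := ltn_ord j.
rewrite degen_rowE// !face_rowE; try lia.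
row_cases t.
Qed.

(** The face map inserts a zero at position [j]; this moves the start of the tail exactly when the
    zero comes before it. *)
Lemma tail_face n (i : nat) (j : 'I_n.+2) (t : simplex R n) :
  tail i.+1 (face j t) = tail (if (j <= i)%N then i else i.+1) t.
Proof.
apply: val_inj.
rewrite -[LHS]/(tail_weight i.+1 (face_row j (set_val t))).
rewrite -[RHS]/(tail_weight _ (set_val t)).
move: (set_val t) => {}t.
rewrite /tail_weight big_mkcond (bigD1_ord j)//= mxE unlift_none if_same add0r.
rewrite [RHS]big_mkcond; apply: eq_bigr => k _; rewrite mxE liftK /= /bump.
by case: (leqP j i) => ji; case: (leqP j k) => jk; congr (if _ then _ else _); lia.
Qed.

Lemma tail_first n (t : simplex R n) : set_val (tail 0 t) = 1.
Proof. by have /set_mem[_] := valP t. Qed.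

Lemma tail_last n (t : simplex R n) : set_val (tail n.+1 t) = 0.
Proof. by apply: big1 => k; rewrite leqNgt ltn_ord. Qed.

End simplices.

(** * Singular chains and the prism operator *)

Section chains.
Variable R : realType.
Implicit Types X Y Z : topologicalType.

HB.instance Definition _ X n :=
  GRing.isLinear.Build rat (chain R X n.+1) (chain R X n) *:%R (@boundary R X n)
    (fglift_is_linear _).

Lemma boundaryU X n (s : singular R X n.+1) :
  boundary << s >> =
  \sum_(i < n.+2) (-1) ^+ i *: << (s \o face i : singular R X n) >>.
Proof. exact: fgliftU. Qed.

Definition push X Y (j : continuousType X Y) n : chain R X n -> chain R Y n :=
  fglift (fun s : singular R X n => << (j \o s : singular R Y n) >>).

HB.instance Definition _ X Y (j : continuousType X Y) n :=
  GRing.isLinear.Build rat (chain R X n) (chain R Y n) *:%R (push j (n := n))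
    (fglift_is_linear _).

Lemma pushU X Y (j : continuousType X Y) n (s : singular R X n) :
  push j << s >> = << (j \o s : singular R Y n) >>.
Proof. exact: fgliftU. Qed.

Lemma push_boundary X Y (j : continuousType X Y) n (c : chain R X n.+1) :
  push j (boundary c) = boundary (push j c).
Proof.
suff : push j (n := n) \o boundary (n := n) =1 boundary (n := n) \o push j (n := n.+1).
  exact.
apply: freeg_linear_ext => s /=.
rewrite pushU !boundaryU linear_sum; apply: eq_bigr => i _.
by rewrite linearZ/= pushU; congr (_ *: << _ >>); apply/continuousEP.
Qed.

Lemma push_comp X Y Z (j : continuousType X Y) (k : continuousType Y Z)
    (l : continuousType X Z) n (c : chain R X n) :
  k \o j =1 l -> push k (push j c) = push l c.
Proof.
move=> kjl.
suff : push k (n := n) \o push j (n := n) =1 push l (n := n) by exact.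
apply: freeg_linear_ext => s /=.
by rewrite !pushU; congr (<< _ >>); apply/continuousEP => t; exact: kjl.
Qed.

Lemma push_id X (j : continuousType X X) n (c : chain R X n) :
  j =1 id -> push j c = c.
Proof.
move=> jid; suff : push j (n := n) =1 idfun by exact.
apply: freeg_linear_ext => s /=.
by rewrite pushU; congr (<< _ >>); apply/continuousEP => t; exact: jid.
Qed.

Lemma cycle_subspace X n : subspace_pred (@Defs.cycle R X n).
Proof.
case: n => [|n]; split=> //= [|a x y x0 y0]; first exact: linear0.
by rewrite linearP/= x0 y0 scaler0 addr0.
Qed.

Definition is_boundary X n (c : chain R X n) := exists b, c = boundary b.

Lemma boundary_subspace X n : subspace_pred (@is_boundary X n).
Proof.
split=> [|a _ _ [x ->] [y ->]]; first by exists 0; rewrite linear0.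
by exists (a *: x + y); rewrite linearP.
Qed.

Lemma betti_isE X n d :
  betti_is R X n d = subquotient_dim (@Defs.cycle R X n) (@is_boundary X n) d.
Proof. by []. Qed.

Lemma betti_is_unique X n d e : betti_is R X n d -> betti_is R X n e -> d = e.
Proof.
rewrite !betti_isE; apply: subquotient_dim_unique.
  exact: cycle_subspace.
exact: boundary_subspace.
Qed.

Lemma betti_isP X n d : betti_is R X n d -> betti R X n = d.
Proof.
move=> Xd; apply: (betti_is_unique _ Xd).
exact: (@xgetPex _ 0%N [set d | betti_is R X n d] (ex_intro _ d Xd)).
Qed.

Lemma push_cycle X Y (j : continuousType X Y) n (c : chain R X n) :
  Defs.cycle c -> Defs.cycle (push j c).
Proof.
by case: n c => // n c /= c0; rewrite -push_boundary c0 linear0.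
Qed.

Lemma push_is_boundary X Y (j : continuousType X Y) n (c : chain R X n) :
  is_boundary c -> is_boundary (push j c).
Proof. by move=> [b ->]; exists (push j b); rewrite push_boundary. Qed.

Section prism.
Variables (X Y : topologicalType).
Variable H : continuousType (X * (`[0, 1]%classic : set R))%type Y.

Lemma prism_simplex_continuous n (i : 'I_n.+1) (s : singular R X n) :
  continuous (fun t : simplex R n.+1 => H (s (degen i t), tail i.+1 t)).
Proof.
apply: (@comp_continuous _ _ _
  (fun t : simplex R n.+1 => (s (degen i t), tail i.+1 t)) H); last exact: cts_fun.
apply: pair_continuous; last exact: tail_continuous.
apply: (@comp_continuous _ _ _ (degen i) s); last exact: cts_fun.
exact: degen_continuous.
Qed.

Lemma slice_simplex_continuous n (i : nat) (s : singular R X n) :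
  continuous (fun t : simplex R n => H (s t, tail i t)).
Proof.
apply: (@comp_continuous _ _ _
  (fun t : simplex R n => (s t, tail i t)) H); last exact: cts_fun.
by apply: pair_continuous; [exact: cts_fun | exact: tail_continuous].
Qed.

(** The [i]-th simplex of the standard triangulation of the prism: its vertices up to [i] lie at
    height 0 and the later ones at height 1. *)
Definition prism_simplex n (i : 'I_n.+1) (s : singular R X n) : singular R Y n.+1 :=
  mkcts (@prism_simplex_continuous n i s).

(** The wall shared by consecutive simplices of the triangulation. Slice 0 is the top of the prism
    and slice [n.+1] the bottom. *)
Definition slice_simplex n (i : nat) (s : singular R X n) : singular R Y n :=
  mkcts (@slice_simplex_continuous n i s).

Definition prism n : chain R X n -> chain R Y n.+1 :=
  fglift (fun s : singular R X n =>
    \sum_(i < n.+1) (-1) ^+ i *: << prism_simplex i s >>).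

HB.instance Definition _ n :=
  GRing.isLinear.Build rat (chain R X n) (chain R Y n.+1) *:%R (prism (n := n))
    (fglift_is_linear _).

Lemma prismU n (s : singular R X n) :
  prism << s >> = \sum_(i < n.+1) (-1) ^+ i *: << prism_simplex i s >>.
Proof. exact: fgliftU. Qed.

(** The prism formula: top minus bottom minus the prism over the boundary. Degree zero is set apart
    because [boundary] is defined on chains of positive degree. *)
Lemma boundary_prismU n (s : singular R X n) :
  boundary (prism << s >>) = << slice_simplex 0 s >> - << slice_simplex n.+1 s >> -
   (if n is m.+1 return singular R X n -> chain R Y n then
      fun s : singular R X m.+1 => prism (boundary << s >>) else fun=> 0) s.
Proof.
(* [A], [B] and the slices are the data of [alternating_prism_sum], indexed by naturals; in degree
   zero [B] gets the dummy value 0. *)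
pose A i j : chain R Y n :=
  << (prism_simplex (inord i : 'I_n.+1) s \o face (inord j) : singular R Y n) >>.
pose B : nat -> nat -> chain R Y n :=
  (if n is m.+1 return singular R X n -> nat -> nat -> chain R Y n then
    fun (s : singular R X m.+1) i j =>
      << prism_simplex (inord i : 'I_m.+1) (s \o face (inord j) : singular R X m) >>
    else fun _ _ _ => 0) s.
transitivity (\sum_(0 <= i < n.+1) \sum_(0 <= j < n.+2) (-1) ^+ (i + j) *: A i j).
  rewrite prismU linear_sum big_mkord; apply: eq_bigr => i _.
  rewrite linearZ/= boundaryU big_mkord scaler_sumr; apply: eq_bigr => j _.
  by rewrite scalerA -exprD /A !inord_val.
rewrite (@alternating_prism_sum _ n A B (fun i => << slice_simplex i s >>)).
- congr (_ - _); rewrite /B {A B}; case: n s => [|n] s; first by rewrite big_nil.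
  rewrite boundaryU linear_sum exchange_big big_mkord; apply: eq_bigr => j _.
  rewrite linearZ/= prismU scaler_sumr big_mkord; apply: eq_bigr => i _.
  by rewrite scalerA -exprD addnC !inord_val.
- move=> i j ij; rewrite /A /B {A B}; case: n s ij => [|n] s ij; first by lia.
  congr (<< _ >>); apply/continuousEP => t /=; rewrite /prism_simplex /mkcts/=.
  congr (H (s _, _)).
    by apply: degen_face_lt; rewrite !inordK//; lia.
  by rewrite tail_face !inordK; [rewrite ifT; [congr tail|]|..]; lia.
- move=> i j ij; rewrite /A /B {A B}; case: n s ij => [|n] s ij; first by lia.
  congr (<< _ >>); apply/continuousEP => t /=; rewrite /prism_simplex /mkcts/=.
  congr (H (s _, _)).
    by apply: degen_face_gt; rewrite !inordK//; lia.
  by rewrite tail_face !inordK; [rewrite ifF; [congr tail|]|..]; lia.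
- move=> i ilen; rewrite /A; congr (<< _ >>); apply/continuousEP => t /=.
  rewrite /prism_simplex /slice_simplex /mkcts/= tail_face.
  by rewrite degen_face_id !inordK ?leqnn ?leqnSn//; lia.
- move=> i ilen; rewrite /A; congr (<< _ >>); apply/continuousEP => t /=.
  rewrite /prism_simplex /slice_simplex /mkcts/= tail_face.
  by rewrite degen_face_id !inordK ?leqnn ?leqnSn ?ltnn//; lia.
Qed.

End prism.

End chains.

Section homotopy_invariance.
Variable R : realType.
Implicit Types X Y : topologicalType.

Lemma boundary_prism0 X Y (H : continuousType (X * (`[0, 1]%classic : set R))%type Y)
    (f g : continuousType X Y) :
  (forall x t, set_val t = 0 -> H (x, t) = f x) ->
  (forall x t, set_val t = 1 -> H (x, t) = g x) ->
  forall c : chain R X 0, boundary (prism H c) = push g c - push f c.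
Proof.
move=> H0 H1.
suff : boundary (n := 0) \o prism H (n := 0) =1 push g (n := 0) \- push f (n := 0).
  by [].
apply: freeg_linear_ext => s /=; rewrite boundary_prismU subr0 !pushU.
by congr (<< _ >> - << _ >>); apply/continuousEP => t /=;
  rewrite /slice_simplex /mkcts/=; [apply/H1/tail_first | apply/H0/tail_last].
Qed.

Lemma boundary_prismS X Y (H : continuousType (X * (`[0, 1]%classic : set R))%type Y)
    (f g : continuousType X Y) :
  (forall x t, set_val t = 0 -> H (x, t) = f x) ->
  (forall x t, set_val t = 1 -> H (x, t) = g x) ->
  forall n (c : chain R X n.+1),
    boundary (prism H c) = push g c - push f c - prism H (boundary c).
Proof.
move=> H0 H1 n.
suff : boundary (n := n.+1) \o prism H (n := n.+1) =1
  push g (n := n.+1) \- push f (n := n.+1) \- (prism H (n := n) \o boundary (n := n)).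
  by [].
apply: freeg_linear_ext => s /=; rewrite boundary_prismU !pushU.
by congr (<< _ >> - << _ >> - _); apply/continuousEP => t /=;
  rewrite /slice_simplex /mkcts/=; [apply/H1/tail_first | apply/H0/tail_last].
Qed.

Lemma homotopic_push X Y (f g : continuousType X Y) n (c : chain R X n) :
  homotopic R f g -> Defs.cycle c -> is_boundary (push g c - push f c).
Proof.
move=> [H [Hc H0 H1]] cc; exists (prism (mkcts Hc) c).
case: n c cc => [|n] c /= cc; first exact/esym/(boundary_prism0 (H := mkcts Hc)).
by rewrite (boundary_prismS (H := mkcts Hc) H0 H1) cc linear0 subr0.
Qed.

Lemma homotopy_equivalent_betti_is X Y n d :
  homotopy_equivalent R X Y -> betti_is R X n d -> betti_is R Y n d.
Proof.
move=> [f [g [cf cg gf fg]]]; rewrite !betti_isE.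
pose F := mkcts cf : continuousType X Y; pose G := mkcts cg : continuousType Y X.
apply: (subquotient_dim_transport (phi := push F (n := n)) (psi := push G (n := n))).
- exact: cycle_subspace.
- exact: boundary_subspace.
- exact: cycle_subspace.
- exact: boundary_subspace.
- exact: push_cycle.
- exact: push_is_boundary.
- exact: push_cycle.
- exact: push_is_boundary.
- move=> c cc /=.
  have idX : continuous (@id X) by move=> x; exact: cvg_id.
  rewrite -{1}(push_id (j := mkcts idX) c)//.
  rewrite (push_comp (l := G \o F))//.
  exact: homotopic_push.
- move=> c cc /=.
  have idY : continuous (@id Y) by move=> x; exact: cvg_id.
  rewrite -{1}(push_id (j := mkcts idY) c)//.
  rewrite (push_comp (l := F \o G))//.
  exact: homotopic_push.
Qed.

Lemma homotopy_equivalent_sym X Y :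
  homotopy_equivalent R X Y -> homotopy_equivalent R Y X.
Proof. by move=> [f [g [cf cg gf fg]]]; exists g, f; split. Qed.

(** The sets of admissible dimensions coincide, so the equality also covers the default value of
    [xget]. *)
Lemma homotopy_equivalent_betti X Y n :
  homotopy_equivalent R X Y -> betti R X n = betti R Y n.
Proof.
move=> XY; congr (xget _ _); apply/seteqP; split=> d /=.
  exact: homotopy_equivalent_betti_is.
exact/homotopy_equivalent_betti_is/homotopy_equivalent_sym.
Qed.

Lemma homotopy_equivalent_euler X Y :
  homotopy_equivalent R X Y -> euler R X = euler R Y.
Proof.
by move=> XY; apply: eq_fsbigr => n _; rewrite (homotopy_equivalent_betti n XY).
Qed.

(** Links the Euler characteristic of the space [X] to that of its full subspace, the form in which
    clopen pieces are cut out. *)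
Lemma homotopy_equivalent_setT X : homotopy_equivalent R X [set: X].
Proof.
pose f (x : X) : [set: X] := SigSub (mem_set I : x \in [set: X]).
have cf : continuous f.
  by apply: continuous_comp_initial => x; exact: cvg_id.
have cg : continuous (set_val : [set: X] -> X) by exact: initial_continuous.
exists f, set_val; split=> //.
- by exists fst; split=> // x; exact: cvg_fst.
- exists fst; split=> [x|x t _|//]; first exact: cvg_fst.
  exact: val_inj.
Qed.

End homotopy_invariance.

(** * Singular simplices do not cross clopen sets *)

Section simplex_connected.
Variable R : realType.

(** The retraction of the line onto the unit interval, written with norms for the sake of
    continuity. *)
Definition clamp (x : R) : R := (1 + `|x| - `|1 - x|) / 2.

Lemma clamp_itv x : 0 <= clamp x <= 1.
Proof.
have := ler_normB 1 x; have := ler_normB 1 (1 - x).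
by rewrite opprB addrC subrK normr1 /clamp; lra.
Qed.

Lemma clamp_continuous : continuous clamp.
Proof.
move=> x; apply: cvgMl; apply: cvgB.
  by apply: cvgD; [exact: cvg_cst | exact: norm_continuous].
apply: (@continuous_comp _ _ _ (fun x : R => 1 - x) Num.norm).
  by apply: cvgB; [exact: cvg_cst | exact: cvg_id].
exact: norm_continuous.
Qed.

Lemma segment_row_simplex n (t u : simplex R n) (x : R) :
  (1 - clamp x) *: set_val t + clamp x *: set_val u \in simplex R n.
Proof.
have /andP[c0 c1] := clamp_itv x.
have /set_mem[t_ge0 t_sum] := valP t; have /set_mem[u_ge0 u_sum] := valP u.
apply/mem_set; split => [j|].
  by rewrite !mxE addr_ge0// mulr_ge0// subr_ge0.
under eq_bigr do rewrite !mxE.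
by rewrite big_split/= -!mulr_sumr t_sum u_sum !mulr1 subrK.
Qed.

Definition simplex_segment n (t u : simplex R n) (x : R) : simplex R n :=
  exist _ ((1 - clamp x) *: set_val t + clamp x *: set_val u)
    (segment_row_simplex t u x).

Lemma simplex_segment_continuous n (t u : simplex R n) :
  continuous (simplex_segment t u).
Proof.
apply: continuous_comp_initial; apply: row_continuous => j.
apply: (@eq_continuous _ _ (fun x =>
  (1 - clamp x) * set_val t 0 j + clamp x * set_val u 0 j)).
  move=> x; rewrite -[RHS]/(((1 - clamp x) *: set_val t + clamp x *: set_val u) 0 j).
  by rewrite !mxE.
move=> x; apply: cvgD; apply: cvgMl; last exact: clamp_continuous.
by apply: cvgB; [exact: cvg_cst | exact: clamp_continuous].
Qed.

(** The simplex is convex, so a segment joins [t] to [u]. Its points sent into [D] form a nonempty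
    clopen part of the connected interval. *)
Lemma singular_clopen (Y : topologicalType) n (s : singular R Y n) (D : set Y) t u :
  clopen D -> D (s t) -> D (s u).
Proof.
move=> [Do Dc] Dst.
pose q := s \o simplex_segment t u.
have cq : continuous q.
  by apply: comp_continuous; [exact: simplex_segment_continuous | exact: cts_fun].
have clamp0 : clamp 0 = 0 by rewrite /clamp normr0 subr0 normr1; lra.
have clamp1 : clamp 1 = 1 by rewrite /clamp normr1 subrr normr0; lra.
have q0 : q 0 = s t.
  congr (s _); apply: val_inj.
  rewrite -[LHS]/((1 - clamp 0) *: set_val t + clamp 0 *: set_val u).
  by rewrite clamp0 subr0 scale1r scale0r addr0.
have q1 : q 1 = s u.
  congr (s _); apply: val_inj.
  rewrite -[LHS]/((1 - clamp 1) *: set_val t + clamp 1 *: set_val u).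
  by rewrite clamp1 subrr scale1r scale0r add0r.
have : `[0, 1]%classic `&` q @^-1` D = `[0, 1]%classic.
  apply: segment_connected.
  - by exists 0; split; rewrite /= ?in_itv/= ?lexx ?ler01// q0.
  - by exists (q @^-1` D) => //; apply: open_comp => // x _; exact: cq.
  - by exists (q @^-1` D) => //; apply: preimage_closed.
move=> /seteqP[_ /(_ 1)][]; first by rewrite /= in_itv/= ler01 lexx.
by rewrite /= q1.
Qed.

(** A base point, at which one tests in which clopen piece a singular simplex lies. *)
Definition simplex_vertex n : simplex R n.
Proof.
exists (delta_mx 0 0); apply/mem_set; split=> [j|]; first by rewrite mxE.
rewrite (bigD1 0)//= mxE !eqxx big1 ?addr0// => j j0.
by rewrite mxE (negbTE j0) andbF.
Defined.

End simplex_connected.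

(** * Additivity of the Euler characteristic over clopen partitions *)

Section subspaces.
Variables (R : realType) (X : topologicalType).
Implicit Types A B P : set X.

Definition incl A B (BA : B `<=` A) (x : B) : A :=
  SigSub (mem_set (BA _ (set_mem (valP x)))).

Lemma incl_continuous A B (BA : B `<=` A) : continuous (incl BA).
Proof. by apply: continuous_comp_initial; exact: initial_continuous. Qed.

HB.instance Definition _ A B (BA : B `<=` A) :=
  isContinuous.Build _ _ (incl BA) (@incl_continuous _ _ BA).

Section restriction.
Variables (A B : set X) (BA : B `<=` A).
Hypothesis B_clopen : clopen (set_val @^-1` B : set A).

Lemma corestrict_continuous n (s : singular R A n)
    (sB : forall t, B (set_val (s t))) :
  continuous (fun t => SigSub (mem_set (sB t)) : B).
Proof.
apply: continuous_comp_initial.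
apply: (@comp_continuous _ _ _ s set_val); first exact: cts_fun.
exact: initial_continuous.
Qed.

Definition corestrict n (s : singular R A n) (sB : forall t, B (set_val (s t))) :
  singular R B n := mkcts (@corestrict_continuous n s sB).

(** Projects chains of [A] onto chains of [B] by dropping every simplex not contained in [B]. For
    [B] clopen in [A] this is a chain map. *)
Definition restrict_simplex n (s : singular R A n) : chain R B n :=
  if pselect (forall t, B (set_val (s t))) is left sB then << corestrict sB >> else 0.

Definition restrict n : chain R A n -> chain R B n := fglift (@restrict_simplex n).

HB.instance Definition _ n :=
  GRing.isLinear.Build rat (chain R A n) (chain R B n) *:%R (@restrict n)
    (fglift_is_linear _).

Lemma restrictU n (s : singular R A n) (s' : singular R B n) :
  (forall t, set_val (s' t) = set_val (s t)) -> restrict << s >> = << s' >>.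
Proof.
move=> ss'; rewrite /restrict fgliftU /restrict_simplex.
case: pselect => [sB|]; last first.
  by case=> t; rewrite -ss'; exact: set_mem (valP (s' t)).
by congr (<< _ >>); apply/continuousEP => t; exact/esym/val_inj/ss'.
Qed.

Lemma restrictU0 n (s : singular R A n) t :
  ~ B (set_val (s t)) -> restrict << s >> = 0.
Proof.
move=> st; rewrite /restrict fgliftU /restrict_simplex.
by case: pselect => // sB; case: st.
Qed.

Lemma restrict_boundary n (c : chain R A n.+1) :
  restrict (boundary c) = boundary (restrict c).
Proof.
suff : @restrict n \o boundary (n := n) =1 boundary (n := n) \o @restrict n.+1.
  exact.
apply: freeg_linear_ext => s /=; rewrite boundaryU linear_sum.
have [sB|] := pselect (forall t, B (set_val (s t))).
  rewrite (restrictU (s' := corestrict sB))// boundaryU; apply: eq_bigr => i _.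
  by rewrite linearZ/= (restrictU (s' := corestrict sB \o face i)).
(* A simplex that leaves [B] somewhere avoids it altogether, so its faces are dropped as well. *)
move=> /existsNP[t st]; rewrite (restrictU0 st) linear0 big1// => i _.
rewrite linearZ/= (restrictU0 (t := simplex_vertex R n)) ?scaler0//= => st'.
exact/st/(singular_clopen (D := set_val @^-1` B) t B_clopen st').
Qed.

Lemma restrict_cycle n (c : chain R A n) : Defs.cycle c -> Defs.cycle (restrict c).
Proof. by case: n c => // n c /= c0; rewrite -restrict_boundary c0 linear0. Qed.

Lemma restrict_is_boundary n (c : chain R A n) :
  is_boundary c -> is_boundary (restrict c).
Proof. by move=> [b ->]; exists (restrict b); rewrite restrict_boundary. Qed.

Lemma push_inclK n : cancel (push (incl BA) (n := n)) (@restrict n).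
Proof.
suff : @restrict n \o push (incl BA) (n := n) =1 idfun by exact.
by apply: freeg_linear_ext => s /=; rewrite pushU (restrictU (s' := s)).
Qed.

End restriction.

(** Each simplex lies wholly in [B] or wholly in [B']: one term returns it and the other
    vanishes. *)
Lemma restrictD A B B' (BA : B `<=` A) (B'A : B' `<=` A) n (c : chain R A n) :
  clopen (set_val @^-1` B : set A) -> A `\` B = B' ->
  push (incl BA) (restrict B c) + push (incl B'A) (restrict B' c) = c.
Proof.
move=> Bc AB.
suff : (push (incl BA) (n := n) \o restrict (A := A) B (n := n)) \+
  (push (incl B'A) (n := n) \o restrict (A := A) B' (n := n)) =1 idfun by exact.
apply: freeg_linear_ext => s /=.
have [sB|sB] := pselect (B (set_val (s (simplex_vertex R n)))).
  have {}sB t : B (set_val (s t)).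
    exact: (singular_clopen (D := set_val @^-1` B) t Bc sB).
  rewrite (restrictU (s' := corestrict sB))// pushU.
  rewrite (restrictU0 (t := simplex_vertex R n)) ?linear0 ?addr0; last first.
    by rewrite -AB => -[_]; apply; exact: sB.
  by congr (<< _ >>); apply/continuousEP => t; exact: val_inj.
have {}sB' t : B' (set_val (s t)).
  rewrite -AB; split; first exact: set_mem (valP (s t)).
  move=> st; apply: sB.
  exact: (singular_clopen (D := set_val @^-1` B) (simplex_vertex R n) Bc st).
rewrite (restrictU0 sB) linear0 add0r.
rewrite (restrictU (s' := corestrict sB'))// pushU.
by congr (<< _ >>); apply/continuousEP => t; exact: val_inj.
Qed.

Lemma clopen_pieces A P : clopen P ->
  clopen (set_val @^-1` (A `&` P) : set A) /\ clopen (set_val @^-1` (A `\` P) : set A).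
Proof.
move=> Pc.
have val_clopen (D : set X) : clopen D -> clopen (set_val @^-1` D : set A).
  by move=> Dc; apply: preimage_clopen => //; exact: initial_continuous.
have BE : set_val @^-1` (A `&` P) = set_val @^-1` P :> set A.
  apply/seteqP; split=> [x []//|x Px]; split=> //; exact: set_mem (valP x).
have BE' : set_val @^-1` (A `\` P) = set_val @^-1` (~` P) :> set A.
  apply/seteqP; split=> [x []//|x Px]; split=> //; exact: set_mem (valP x).
by rewrite BE BE'; split; apply: val_clopen => //; exact: clopenC.
Qed.

(** Pushes and restrictions display the chains of [A] as the direct sum of those of the two pieces,
    compatibly with boundaries. *)
Lemma betti_is_split A P n d : clopen P -> betti_is R A n d ->
  exists d1 d2, [/\ betti_is R (A `&` P) n d1, betti_is R (A `\` P) n d2 &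
    d = (d1 + d2)%N].
Proof.
move=> Pc; have [Bc Bc'] := clopen_pieces A Pc.
apply: (@subquotient_dim_split _ _ _ _ (@Defs.cycle R A n) (@is_boundary R A n)
  (@Defs.cycle R (A `&` P) n) (@is_boundary R (A `&` P) n)
  (@Defs.cycle R (A `\` P) n) (@is_boundary R (A `\` P) n) d
  (push (incl (@subIsetl _ A P)) (n := n)) (restrict (A := A) (A `&` P) (n := n))
  (push (incl (@subDsetl _ A P)) (n := n)) (restrict (A := A) (A `\` P) (n := n))).
all: try exact: cycle_subspace.
all: try exact: boundary_subspace.
all: try exact: push_cycle.
all: try exact: push_is_boundary.
all: try exact: restrict_cycle.
all: try exact: restrict_is_boundary.
all: try exact: push_inclK.
by move=> c; apply: restrictD => //; apply/seteqP; split=> x /=; tauto.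
Qed.

Lemma betti_is_join A P n d1 d2 : clopen P ->
  betti_is R (A `&` P) n d1 -> betti_is R (A `\` P) n d2 ->
  betti_is R A n (d1 + d2).
Proof.
move=> Pc; have [Bc Bc'] := clopen_pieces A Pc.
apply: (@subquotient_dim_join _ _ _ _ (@Defs.cycle R A n) (@is_boundary R A n)
  (@Defs.cycle R (A `&` P) n) (@is_boundary R (A `&` P) n)
  (@Defs.cycle R (A `\` P) n) (@is_boundary R (A `\` P) n) d1 d2
  (push (incl (@subIsetl _ A P)) (n := n)) (restrict (A := A) (A `&` P) (n := n))
  (push (incl (@subDsetl _ A P)) (n := n)) (restrict (A := A) (A `\` P) (n := n))).
all: try exact: cycle_subspace.
all: try exact: boundary_subspace.
all: try exact: push_cycle.
all: try exact: push_is_boundary.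
all: try exact: restrict_cycle.
all: try exact: restrict_is_boundary.
all: try exact: push_inclK.
by move=> c; apply: restrictD => //; apply/seteqP; split=> x /=; tauto.
Qed.

End subspaces.

Section euler_additivity.
Variable R : realType.

Lemma fsbig_initial (V : nmodType) (F : nat -> V) N :
  (forall n, (N <= n)%N -> F n = 0) -> \sum_(n \in [set: nat]) F n = \sum_(n < N) F n.
Proof.
move=> FN; rewrite fsbig_ord; apply/esym/fsbig_widen => // n [_ /= nN].
by apply: FN; rewrite leqNgt; exact/negP.
Qed.

Lemma euler_sum (X : topologicalType) N :
  (forall n, (N <= n)%N -> betti_is R X n 0) ->
  euler R X = \sum_(n < N) (-1) ^+ n * (betti R X n)%:Z.
Proof.
by move=> XN; apply: fsbig_initial => n /XN /betti_isP ->; rewrite mulr0.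
Qed.

(** Unlike [euler], it cannot grow on passing to a clopen piece, so one bound on a set serves for
    all its fibers. *)
Definition total_betti (X : topologicalType) : nat :=
  \sum_(n \in [set: nat]) betti R X n.

Lemma total_betti_sum (X : topologicalType) N :
  (forall n, (N <= n)%N -> betti_is R X n 0) ->
  total_betti X = (\sum_(n < N) betti R X n)%N.
Proof. by move=> XN; apply: fsbig_initial => n /XN /betti_isP ->. Qed.

Lemma homotopy_equivalent_total_betti (X Y : topologicalType) :
  homotopy_equivalent R X Y -> total_betti X = total_betti Y.
Proof. by move=> XY; apply: eq_fsbigr => n _; exact: homotopy_equivalent_betti. Qed.

Lemma euler_le_total_betti (X : topologicalType) :
  finite_euler R X -> `|euler R X| <= (total_betti X)%:Z.
Proof.
move=> [_ [N XN]]; rewrite (euler_sum XN) (total_betti_sum XN).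
rewrite (le_trans (ler_norm_sum _ _ _))// -[leRHS]natz natr_sum ler_sum// => n _.
by rewrite normrM normrX normrN1 expr1n mul1r natz.
Qed.

Variable X : topologicalType.
Implicit Types A P : set X.

Lemma euler_split A P : clopen P -> finite_euler R A ->
  [/\ finite_euler R (A `&` P), finite_euler R (A `\` P),
    euler R A = euler R (A `&` P) + euler R (A `\` P) &
    (total_betti (A `&` P) <= total_betti A)%N].
Proof.
move=> Pc [Ad [N AN]].
have PN n : (N <= n)%N ->
    betti_is R (A `&` P) n 0 /\ betti_is R (A `\` P) n 0.
  move=> /AN /(betti_is_split Pc)[d1 [d2 []]] + + /esym/eqP.
  move=> P1 P2; rewrite addn_eq0 => /andP[/eqP d10 /eqP d20].
  by rewrite d10 d20 in P1 P2.
have PN1 n Nn := (PN n Nn).1; have PN2 n Nn := (PN n Nn).2.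
have betE n : betti R A n = (betti R (A `&` P) n + betti R (A `\` P) n)%N.
  have [d /[dup] Adn /(betti_is_split Pc)[d1 [d2 [Ad1 Ad2 dE]]]] := Ad n.
  by rewrite (betti_isP Adn) (betti_isP Ad1) (betti_isP Ad2).
split.
- split; last by exists N.
  by move=> n; have [d /(betti_is_split Pc)[d1 [d2 [? ? ?]]]] := Ad n; exists d1.
- split; last by exists N.
  by move=> n; have [d /(betti_is_split Pc)[d1 [d2 [? ? ?]]]] := Ad n; exists d2.
- rewrite (euler_sum AN) (euler_sum PN1) (euler_sum PN2) -big_split/=.
  by apply: eq_bigr => n _; rewrite betE PoszD mulrDr.
- rewrite (total_betti_sum AN) (total_betti_sum PN1).
  by apply: leq_sum => n _; rewrite betE leq_addr.
Qed.

Lemma finite_euler_join A P : clopen P ->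
  finite_euler R (A `&` P) -> finite_euler R (A `\` P) -> finite_euler R A.
Proof.
move=> Pc [P1 [N1 PN1]] [P2 [N2 PN2]]; split=> [n|].
  have [d1 Pd1] := P1 n; have [d2 Pd2] := P2 n.
  by exists (d1 + d2)%N; exact: betti_is_join Pd1 Pd2.
exists (maxn N1 N2) => n; rewrite geq_max => /andP[/PN1 Pn1 /PN2 Pn2].
exact: (betti_is_join Pc Pn1 Pn2).
Qed.

(** The empty set splits into two copies of itself, so its Euler characteristic equals its own
    double. *)
Lemma euler_set0 : finite_euler R (set0 : set X) -> euler R (set0 : set X) = 0.
Proof.
move=> /(euler_split (@clopenT X))[_ _ + _]; rewrite set0I set0D.
by move=> E; apply: (addrI (euler R (set0 : set X))); rewrite -E addr0.
Qed.

(** One fiber is removed at a time. Finiteness of [A] is proved along with the formula, because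
    splitting [A] presupposes it. *)
Lemma euler_fibers (h : X -> R) (s : seq R) A :
  (forall c, clopen (h @^-1` [set c])) -> finite_euler R (set0 : set X) ->
  uniq s -> A `<=` [set x | h x \in s] ->
  (forall c, finite_euler R (A `&` h @^-1` [set c])) ->
  finite_euler R A /\ euler R A = \sum_(c <- s) euler R (A `&` h @^-1` [set c]).
Proof.
move=> hc f0; elim: s A => [|c s IH] A.
  move=> _ As _; have -> : A = set0 by rewrite -subset0 => x /As.
  by rewrite big_nil euler_set0.
move=> /= /andP[cs us] As Af; rewrite big_cons.
have AcE d : d != c ->
    (A `\` h @^-1` [set c]) `&` h @^-1` [set d] = A `&` h @^-1` [set d].
  move=> dc; apply/seteqP; split=> x /=; first by move=> [[? ?] ?]; split.
  by move=> [Ax hx]; split=> //; split=> //; rewrite hx; exact/eqP.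
have Acc : (A `\` h @^-1` [set c]) `&` h @^-1` [set c] = set0.
  by rewrite -subset0 => x [[_ ?] ?].
have [||Acf AcS] := IH (A `\` h @^-1` [set c]) us.
- by move=> x [/As /= + hx]; rewrite in_cons => /orP[/eqP|].
- by move=> d; have [->|dc] := eqVneq d c; [rewrite Acc | rewrite AcE].
have Af' : finite_euler R A by exact: finite_euler_join (Af c) Acf.
split=> //; have [_ _ -> _] := euler_split (hc c) Af'; rewrite AcS; congr (_ + _).
apply: eq_big_seq => d ds; rewrite AcE//.
by apply: contraNneq cs => <-.
Qed.

End euler_additivity.

(** * Integrals of measurable sums of coboundaries *)

Section translations.
Variable R : realType.
Local Notation mu := (@lebesgue_measure R).
Implicit Types (f g : R -> R) (a : R).

Definition integrable_line f := mu.-integrable setT (EFin \o f).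

(** The pushforward of the measure along [phi] is the measure itself, so this is the change of
    variables for pushforwards. *)
Lemma measure_preserving_integral (phi : R -> R) f :
  measurable_fun setT phi ->
  (forall A : set R, measurable A -> mu (phi @^-1` A) = mu A) ->
  integrable_line f -> integrable_line (f \o phi) /\
  \int[mu]_x (f (phi x)) = \int[mu]_x f x.
Proof.
move=> mphi phiP fi.
have mf0 : measurable_fun [set: R] f.
  by apply/measurable_EFinP; exact: measurable_int fi.
have mf : measurable_fun [set: R] (fun x => (f x)%:E) by exact/measurable_EFinP.
pose mphi_mixin :=
  isMeasurableFun.Build _ _ (measurableTypeR R) (measurableTypeR R) phi mphi.
pose phim : {mfun measurableTypeR R >-> measurableTypeR R} := HB.pack phi mphi_mixin.
have phiE (g : R -> \bar R) :
    (\int[pushforward mu phim]_x g x = \int[mu]_x g x)%E.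
  by apply: eq_measure_integral => A mA _; exact: phiP.
have fphi : integrable_line (f \o phi).
  apply/integrableP; split.
    have -> : EFin \o (f \o phi) = (EFin \o f) \o phi by [].
    have mfphi : measurable_fun [set: R] ((fun x => (f x)%:E) \o phi).
      exact: measurableT_comp mf mphi.
    exact: mfphi.
  have /integrableP[_] := fi; congr (_ < _)%E.
  rewrite -phiE.
  apply: (@ge0_integral_pushforward _ _ (measurableTypeR R) (measurableTypeR R)
    R phi mphi mu setT (fun x => `|(f x)%:E|%E) measurableT) => //.
  by apply: measurableT_comp.
split=> //; congr fine.
rewrite -[RHS]phiE; apply/esym.
exact: (@integral_pushforward _ _ (measurableTypeR R) (measurableTypeR R) R phi
  mphi mu setT (EFin \o f) mf fphi measurableT).
Qed.

Lemma integral_line_shift f a : integrable_line f ->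
  integrable_line (fun x => f (x - a)) /\
  \int[mu]_x f (x - a) = \int[mu]_x f x.
Proof.
apply: (@measure_preserving_integral (fun x => x - a)).
  by apply: measurable_funB => //; exact: measurable_cst.
have mphi : measurable_fun [set: measurableTypeR R]
    (fun x => x - a : measurableTypeR R).
  by apply: measurable_funB => //; exact: measurable_cst.
pose mphi_mixin :=
  isMeasurableFun.Build _ _ (measurableTypeR R) (measurableTypeR R) _ mphi.
pose phim : {mfun measurableTypeR R >-> measurableTypeR R} :=
  HB.pack (fun x : R => x - a) mphi_mixin.
move=> A mA; apply/esym.
(* By uniqueness of Lebesgue measure, only half-open intervals have to be compared. *)
apply: (@lebesgue_measure_unique R (pushforward mu phim)) => //= _ [[b c] _ <-].
rewrite /pushforward/= (_ : _ @^-1` _ = `](b + a), (c + a)]%classic); last first.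
  by apply/seteqP; split=> x /=; rewrite !in_itv/= ltrBrDr lerBlDr.
by rewrite !lebesgue_measure_itv/= !lte_fin ltrD2r -!EFinB opprD addrACA subrr addr0.
Qed.

Lemma integral_line_opp f : integrable_line f ->
  integrable_line (fun x => f (- x)) /\
  \int[mu]_x f (- x) = \int[mu]_x f x.
Proof.
apply: (@measure_preserving_integral -%R); first exact: oppr_measurable.
exact: lebesgue_measureN.
Qed.

End translations.

(** * Averaging over translations *)

Section amenability.
Variable R : realType.
Local Notation mu := (@lebesgue_measure R).
Implicit Types (f g : R -> R) (a : R).

Lemma integrable_lineD f g : integrable_line f -> integrable_line g ->
  integrable_line (fun x => f x + g x).
Proof.
move=> fi gi; apply: eq_integrable (integrableD _ fi gi) => //.
Qed.

Lemma integrable_lineB f g : integrable_line f -> integrable_line g ->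
  integrable_line (fun x => f x - g x).
Proof. by move=> fi gi; apply: eq_integrable (integrableB _ fi gi). Qed.

Lemma integrable_lineZ k f : integrable_line f -> integrable_line (fun x => k * f x).
Proof. by move=> fi; apply: eq_integrable (integrableZl _ k fi). Qed.

Definition shift_mean N a f (u : R) : R :=
  N.+1%:R^-1 * \sum_(j < N.+1) f (u - j%:R * a).

Lemma integral_shift_mean N a f : integrable_line f ->
  integrable_line (shift_mean N a f) /\
  \int[mu]_x shift_mean N a f x = \int[mu]_x f x.
Proof.
move=> fi.
have sP n : integrable_line (fun u => \sum_(j < n) f (u - j%:R * a)) /\
    \int[mu]_u \sum_(j < n) f (u - j%:R * a) = n%:R * \int[mu]_x f x.
  elim: n => [|n [IHi IHE]].
    have E : (fun u => \sum_(j < 0) f (u - j%:R * a)) = cst 0.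
      by apply/funext => u; rewrite big_ord0.
    rewrite E; split; first exact: integrable0.
    by rewrite mul0r Rintegral_cst// mul0r.
  have E : (fun u => \sum_(j < n.+1) f (u - j%:R * a)) =
      (fun u => \sum_(j < n) f (u - j%:R * a) + f (u - n%:R * a)).
    by apply/funext => u; rewrite big_ord_recr.
  rewrite E; have [fin finE] := integral_line_shift (n%:R * a) fi.
  split; first exact: integrable_lineD.
  by rewrite RintegralD// IHE finE -[n.+1]addn1 natrD mulrDl mul1r.
have [si sE] := sP N.+1; split; first exact: integrable_lineZ.
by rewrite RintegralZl// sE mulrA mulVf ?mul1r// pnatr_eq0.
Qed.

(** A substitute for integrability that makes sense for non-measurable functions. *)
Definition dominated f := exists2 K, integrable_line K & forall u, `|f u| <= K u.

Lemma shift_mean_le N a f g u : (forall u, `|f u| <= g u) ->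
  `|shift_mean N a f u| <= shift_mean N a g u.
Proof.
move=> fg; rewrite /shift_mean normrM ger0_norm ?invr_ge0//.
rewrite ler_wpM2l ?invr_ge0//.
by rewrite (le_trans (ler_norm_sum _ _ _))// ler_sum.
Qed.

Lemma dominated_shift_mean N a f : dominated f -> dominated (shift_mean N a f).
Proof.
move=> [K Ki fK]; exists (shift_mean N a K).
  exact: (integral_shift_mean N a Ki).1.
by move=> u; exact: shift_mean_le.
Qed.

(** The sum telescopes, leaving only the two extreme translates. *)
Lemma shift_mean_coboundary N a f u :
  shift_mean N a (fun x => f (x - a) - f x) u =
  N.+1%:R^-1 * (f (u - N.+1%:R * a) - f u).
Proof.
rewrite /shift_mean; congr (_ * _).
rewrite -(big_mkord xpredT (fun j => f (u - j%:R * a - a) - f (u - j%:R * a))).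
rewrite (eq_bigr (fun j => f (u - j.+1%:R * a) - f (u - j%:R * a))); last first.
  by move=> j _; rewrite -addrA -opprD -[j.+1]addn1 natrD mulrDl mul1r.
by rewrite (telescope_sumr (fun j => f (u - j%:R * a)))// mul0r subr0.
Qed.

(** By induction on the number of coboundaries, with the error [r] general: the averaged coboundary
    of the first function is absorbed into [r]. The others remain coboundaries, of averaged
    functions, because translations commute. Only [f], [r] and the dominating functions are ever
    integrated. *)
Lemma coboundary_integral_le (I : Type) (s : seq I) (a : I -> R) (g : I -> R -> R) f r :
  (forall i, dominated (g i)) -> integrable_line f -> integrable_line r ->
  (forall u, `|f u - \sum_(i <- s) (g i (u - a i) - g i u)| <= r u) ->
  `|\int[mu]_x f x| <= \int[mu]_x r x.
Proof.
elim: s g f r => [|m s IH] g f r gdom fi ri fr.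
  rewrite (le_trans (le_normr_Rintegral _ _))//.
  apply: le_Rintegral => //; first exact: integrable_norm.
  by move=> u _; have := fr u; rewrite big_nil subr0.
have [K Ki gK] := gdom m.
(* Letting [N] grow removes the second term. *)
suff step N : `|\int[mu]_x f x| <= \int[mu]_x r x + N.+1%:R^-1 * (2 * \int[mu]_x K x).
  apply/ler_addgt0Pr => e e0.
  set C := 2 * _ in step.
  have [N CN] : exists N : nat, C < e * N.+1%:R.
    exists (Num.truncn `|C / e|).
    rewrite mulrC -ltr_pdivrMr//; apply: le_lt_trans (ler_norm _) _.
    by rewrite Num.Theory.truncnS_gt.
  apply: (le_trans (step N)); rewrite lerD2l mulrC ler_pdivrMr ?ltr0n//.
  exact: ltW.
(* Averaging changes neither the integral of [f] nor that of [r]. *)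
have [fi' <-] := integral_shift_mean N (a m) fi.
have [ri' <-] := integral_shift_mean N (a m) ri.
have [Ki' KE] := integral_line_shift (N.+1%:R * a m) Ki.
have -> : 2 * \int[mu]_x K x = \int[mu]_x (K (x - N.+1%:R * a m) + K x).
  by rewrite RintegralD// KE -[2]/(1 + 1) mulrDl mul1r.
have KKi := integrable_lineD Ki' Ki.
rewrite -RintegralZl// -RintegralD//; last exact: integrable_lineZ.
apply: (IH (fun i => shift_mean N (a m) (g i))) => //.
- by move=> i; exact: dominated_shift_mean.
- by apply: integrable_lineD => //; exact: integrable_lineZ.
move=> u.
(* The average of the full difference, bounded by the average of [r], plus the averaged coboundary
   of [g m], bounded by two translates of [K] over [N.+1]. *)
have -> : shift_mean N (a m) f u -
    \sum_(i <- s) (shift_mean N (a m) (g i) (u - a i) - shift_mean N (a m) (g i) u) =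
  shift_mean N (a m) (fun u => f u - \sum_(i <- m :: s) (g i (u - a i) - g i u)) u +
  shift_mean N (a m) (fun x => g m (x - a m) - g m x) u.
  have subDrKl (x y z : R) : x - (z + y) + z = x - y.
    by rewrite [z + y]addrC opprD addrA subrK.
  rewrite /shift_mean -mulrDr -big_split/=.
  under [in RHS]eq_bigr do rewrite big_cons/= subDrKl.
  rewrite [in RHS]sumrB [RHS]mulrBr; congr (_ - _).
  rewrite exchange_big mulr_sumr; apply: eq_bigr => i _ /=.
  rewrite -mulrBr -sumrB; congr (_ * _); apply: eq_bigr => j _.
  by rewrite addrAC.
apply: (le_trans (ler_normD _ _)); apply: lerD; first exact: shift_mean_le.
rewrite shift_mean_coboundary normrM ger0_norm ?invr_ge0// ler_wpM2l ?invr_ge0//.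
by rewrite (le_trans (ler_normB _ _))// lerD.
Qed.

End amenability.

(** * Dominated functions and even functions *)

Section dominated_functions.
Variable R : realType.
Local Notation mu := (@lebesgue_measure R).
Implicit Types (f g : R -> R) (a : R).

Lemma dominatedD f g : dominated f -> dominated g -> dominated (fun x => f x + g x).
Proof.
move=> [K Ki fK] [L Li gL]; exists (fun x => K x + L x); first exact: integrable_lineD.
by move=> u; rewrite (le_trans (ler_normD _ _))// lerD.
Qed.

Lemma dominatedZ k f : dominated f -> dominated (fun x => k * f x).
Proof.
move=> [K Ki fK]; exists (fun x => `|k| * K x); first exact: integrable_lineZ.
by move=> u; rewrite normrM ler_wpM2l.
Qed.

Lemma dominated_sum (I : Type) (s : seq I) (f : I -> R -> R) :
  (forall i, dominated (f i)) -> dominated (fun x => \sum_(i <- s) f i x).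
Proof.
move=> fd; elim: s => [|i s IH].
  exists (cst 0); first exact: integrable0.
  by move=> u; rewrite big_nil normr0.
have -> : (fun x => \sum_(j <- i :: s) f j x) =
    (fun x => f i x + \sum_(j <- s) f j x) by apply/funext => x; rewrite big_cons.
exact: dominatedD.
Qed.

Lemma dominated_shift f a : dominated f -> dominated (fun x => f (x - a)).
Proof.
move=> [K Ki fK]; exists (fun x => K (x - a)) => //.
exact: (integral_line_shift a Ki).1.
Qed.

Lemma dominated_opp f : dominated f -> dominated (fun x => f (- x)).
Proof.
by move=> [K Ki fK]; exists (fun x => K (- x)) => //; exact: (integral_line_opp Ki).1.
Qed.

Lemma dominated_compact f M B : 0 <= B ->
  (forall u, `|f u| <= B) -> (forall u, M < `|u| -> f u = 0) -> dominated f.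
Proof.
move=> B0 fB f0; exists (fun u => B * \1_(`[- M, M]%classic) u).
  by apply: integrable_lineZ; exact: integrable_indic_itv.
move=> u; rewrite indicE; have [|uM] := boolP (u \in `[- M, M]%classic).
  by rewrite mulr1.
rewrite f0 ?normr0 ?mulr0// ltNge; apply: contra uM.
by rewrite ler_norml => uM; apply/mem_set; rewrite /= in_itv.
Qed.

Lemma dominated_integrable f :
  dominated f -> measurable_fun [set: R] f -> integrable_line f.
Proof.
move=> [K Ki fK] mf; apply: le_integrable Ki => //.
  exact/measurable_EFinP.
by move=> u _ /=; rewrite lee_fin (le_trans (fK u))// ler_norm.
Qed.

Lemma even_measurable f : f =1 f \o -%R ->
  measurable_fun (`[0, +oo[%classic : set R) f -> measurable_fun [set: R] f.
Proof.
move=> fe mf.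
have -> : f = f \o Num.norm.
  by apply/funext => x /=; case: (ger0P x) => // _; exact: fe.
apply: (measurable_comp _ _ mf); first exact: measurable_itv.
  by move=> _ [x _ <-]; rewrite /= in_itv/= normr_ge0.
exact: normr_measurable.
Qed.

Lemma indicator0_integral k : integrable_line (fun u : R => k * \1_[set 0] u) /\
  \int[mu]_u (k * \1_[set 0] u) = 0.
Proof.
have i0 : integrable_line (\1_[set 0] : R -> R).
  by have := @integrable_indic_itv R 0 0 true false; rewrite set_itv1.
split; first exact: integrable_lineZ.
rewrite RintegralZl// (_ : Rintegral _ _ _ = 0) ?mulr0//.
rewrite /Rintegral integral_indic// setIT.
exact: (congr1 fine (@lebesgue_measure_set1 R 0)).
Qed.

Lemma even_integral f : f =1 f \o -%R -> integrable_line f ->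
  \int[mu]_x f x = 2 * \int[mu]_(x in `[0, +oo[) f x.
Proof.
move=> fe fi; rewrite [in RHS]Rintegral_mkcond.
set H := f \_ `[0, +oo[.
have Hi : integrable_line H.
  have := (@integrable_mkcond _ _ _ mu `[0, +oo[%classic (EFin \o f)
    (measurable_itv _)).1.
  move=> /(_ (integrableS _ _ _ fi)) E; rewrite /integrable_line.
  suff -> : EFin \o H = (EFin \o f) \_ `[0, +oo[ by exact: E.
  by apply/funext => x; rewrite /H /patch/=; case: ifP.
have [Hni HnE] := integral_line_opp Hi.
have [zi zE] := indicator0_integral (f 0).
(* [H] and its reflection both count the origin, whence the correction by an indicator. *)
have -> : \int[mu]_x f x = \int[mu]_x (H x + H (- x) - f 0 * \1_[set 0] x).
  apply: eq_Rintegral => x _; rewrite /H /patch indicE !mem_setE !in_itv/= !andbT.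
  have -> : (x \in [set 0]) = (x == 0).
    by apply/idP/eqP => [/set_mem|->]; [|exact/mem_set].
  rewrite oppr_ge0; case: (ltgtP x 0) => [x0|x0|->].
  - by rewrite add0r mulr0 subr0 fe.
  - by rewrite addr0 mulr0 subr0.
  - by rewrite oppr0 mulr1 addrK.
rewrite RintegralB//; last exact: integrable_lineD.
by rewrite RintegralD// zE subr0 HnE -[2]/(1 + 1) mulrDl mul1r.
Qed.

End dominated_functions.

(** * The Euler integrands *)

Section locally_constant.
Variable R : realType.

(** What [homotopy_type_changes_finitely] yields for an invariant of the homotopy type. *)
Definition constant_off (T : Type) (s : seq R) (e : R -> T) :=
  forall u v, u <= v -> (forall w, w \in s -> ~~ (u <= w <= v)) -> e u = e v.

(** The position of [u] relative to the points of [s] determines [e u], and there are finitely many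
    such positions. *)
Lemma constant_off_bounded (s : seq R) (e : R -> nat) :
  constant_off s e -> exists B, forall u, (e u <= B)%N.
Proof.
move=> es.
pose pat u := [ffun i : 'I_(size s) => (s`_i <= u, s`_i < u)].
have pat_eq u v : u <= v -> pat u = pat v -> e u = e v.
  move=> uv puv; have [[w ws /andP[uw wv]]|nw] :=
      pselect (exists2 w, w \in s & u <= w <= v); last first.
    by apply: es => // w ws; apply/negP => uwv; apply: nw; exists w.
  have ws' : (index w s < size s)%N by rewrite index_mem.
  (* A point [w] of [s] in between is at most [v], hence at most [u], hence equal to [u]; then it is
     not below [v] either, and [u = w = v]. *)
  have := congr1 (fun p : {ffun _ -> _} => p (Ordinal ws')) puv.
  rewrite !ffunE /= nth_index// wv => -[wu]; rewrite [w < u]ltNge uw/= => wv'.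
  have <- : w = u by apply/le_anti; rewrite wu uw.
  by have <- : w = v; [apply/le_anti; rewrite wv leNgt -wv'|].
(* Patterns that do not occur get the value 0. *)
pose B p := if pselect (exists u, pat u = p) is left P then e (projT1 (cid P)) else 0%N.
exists (\max_p B p) => u.
have -> : e u = B (pat u).
  rewrite /B; case: pselect => [P|[]]; last by exists u.
  case: (cid P) => v /= pv; have [uv|/ltW vu] := leP u v.
    exact: pat_eq.
  by apply/esym/pat_eq.
exact: leq_bigmax.
Qed.

(** A preimage is the union of its finite part in [s] and of a part that is open, since [e] is
    constant near each point off [s]. *)
Lemma constant_off_measurable (s : seq R) (e : R -> R) :
  constant_off s e -> measurable_fun [set: R] e.
Proof.
move=> es _ Y mY; rewrite setTI.
rewrite -(setUIDK (e @^-1` Y) [set` s]).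
have fs : finite_set [set` s] by exact: finite_seq.
apply: measurableU.
  apply: countable_measurable; first by move=> x; exact: measurable_set1.
  by apply: finite_set_countable; apply: sub_finite_set fs => x [].
apply: open_measurable; rewrite openE => u [/= Yu us].
have : nbhs u (~` [set` s]).
  apply: open_nbhs_nbhs; split=> //; apply: closed_openC.
  apply: (@accessible_finite_set_closed R).1 => //.
  exact: hausdorff_accessible (@norm_hausdorff _ R^o).
move=> /nbhs_ballP[r r0 ur]; apply/nbhs_ballP; exists r => // v uv.
have ball_itv w : Num.min u v <= w <= Num.max u v -> ~ w \in s.
  move=> uwv; apply: ur; move: uv uwv; rewrite /ball/= !ltr_distl.
  rewrite ge_min le_max => /andP[uv1 uv2] /andP[/orP mw /orP wm].
  have r0' : 0 < r := r0.
  by apply/andP; split; case: mw => ?; case: wm => ?; lra.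
split => /=; last exact: ur.
suff <- : e u = e v by [].
have [leuv|/ltW levu] := leP u v.
  apply: es => // w ws; apply/negP => uwv; apply: (ball_itv w) => //.
  by rewrite min_l// max_r.
apply/esym; apply: es => // w ws; apply/negP => uwv; apply: (ball_itv w) => //.
by rewrite min_r// max_l.
Qed.

End locally_constant.

(** * Ranges and fibers over a compact space *)

Section compact_range.
Variables (R : realType) (X : topologicalType).
Hypothesis X_compact : compact [set: X].
Implicit Types f h : X -> R.

Lemma range_compact f : continuous f -> compact (range f).
Proof. by move=> cf; apply: continuous_compact => //; exact: continuous_subspaceT. Qed.

Lemma range_bounded f : continuous f -> exists2 M, 0 <= M & forall x, `|f x| <= M.
Proof.
move=> /range_compact/(@compact_bounded R R^o)/pinfty_ex_gt0[M M0 fM].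
by exists M => [|x]; [exact: ltW | apply: fM; exists x].
Qed.

(** An infinite bounded range would have a limit point; the range being closed, it would contain
    that point, which is not isolated. *)
Lemma range_finite h : continuous h -> isolated (range h) = range h ->
  exists2 s : seq R, uniq s & forall x, h x \in s.
Proof.
move=> ch hd; have hc := range_compact ch.
have [|inf] := pselect (finite_set (range h)).
  move=> /finite_seqP[s hs]; exists (undup s); first exact: undup_uniq.
  move=> x; rewrite mem_undup; have : range h (h x) by exists x.
  by rewrite hs.
have [l lh] := infinite_bounded_limit_point_nonempty inf
  (@compact_bounded R R^o _ hc).
have lr : range h l.
  have := compact_closed (@norm_hausdorff _ R^o) hc; apply.
  exact: subset_limit_point.
have := disjoint_isolated_limit_point (range h); rewrite hd => /disj_setPS/(_ l).
by case; split.
Qed.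

Lemma fiber_clopen h c : continuous h -> isolated (range h) = range h ->
  clopen (h @^-1` [set c]).
Proof.
move=> ch hd; split; last first.
  apply: preimage_closed => //; exact: closed_eq.
rewrite openE => x /= hx.
have : isolated (range h) c by rewrite hd; exists x.
move=> [_ [V cV Vh]]; rewrite -hx in cV.
have xV : nbhs x (h @^-1` V) := ch x _ cV.
apply: filterS xV => y Vy.
by have : [set c] (h y) by rewrite -Vh; split=> //; exists y.
Qed.

End compact_range.

(** Evenness turns the integral over the half-line into half of an integral over the line, on which
    translations act. *)
Lemma upper_euler_integrand_even (R : realType) (X : topologicalType) (f : X -> R) :
  upper_euler_integrand f =1 upper_euler_integrand f \o -%R.
Proof.
by move=> u; rewrite /upper_euler_integrand /euler_gt /= opprK addrAC.
Qed.

Lemma tame_integrand_measurable (R : realType) (X : topologicalType) (f : X -> R) :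
  tame f -> measurable_fun [set: R] (upper_euler_integrand f).
Proof.
move=> [_ [s fs] _ _].
have ms : measurable_fun [set: R] (fun u => (euler_le f u)%:~R : R).
  apply: (@constant_off_measurable _ s) => u v uv suv.
  by congr (_%:~R); exact/homotopy_equivalent_euler/fs.
have -> : upper_euler_integrand f = (fun u => (euler R X)%:~R - (euler_le f u)%:~R
    - ((fun u => (euler_le f u)%:~R : R) \o -%R) u).
  by apply/funext => u; rewrite /upper_euler_integrand /euler_gt !rmorphB.
apply: measurable_funB; first by apply: measurable_funB => //; exact: measurable_cst.
apply: measurableT_comp => //; exact: oppr_measurable.
Qed.

(** * Decomposition over the levels of [h] *)

Section finitely_many_levels.
Variables (R : realType) (X : topologicalType) (h f : X -> R) (s : seq R) (M : R).
Hypotheses (f_tame : tame f) (h_clopen : forall c, clopen (h @^-1` [set c])).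
Hypotheses (s_uniq : uniq s) (hs : forall x, h x \in s).
Hypotheses (M_ge0 : 0 <= M) (fM : forall x, `|f x| <= M).
Local Notation fiber c := (h @^-1` [set c]).

Definition fiber_euler_le c u : R := (euler R (sublevel f u `&` fiber c))%:~R.
Local Notation e := fiber_euler_le.

Definition fiber_euler c : R := (euler R (fiber c))%:~R.
Local Notation chi := fiber_euler.

Definition unit_step (c u : R) : R := (c <= u)%R%:R.

Lemma sublevel_low u : u < - M -> sublevel f u = set0.
Proof.
move=> uM; rewrite -subset0 => x /= fxu; have := fM x.
by rewrite ler_norml => /andP[+ _]; rewrite leNgt (le_lt_trans fxu).
Qed.

Lemma sublevel_high u : M <= u -> sublevel f u = setT.
Proof.
move=> Mu; rewrite -subTset => x _ /=.
exact: le_trans (ler_norm _) (le_trans (fM x) Mu).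
Qed.

Lemma finite_euler_fiber_le c u : finite_euler R (sublevel f u `&` fiber c).
Proof.
by have [_ _ _ /(_ u)[fu _]] := f_tame; have [] := euler_split (h_clopen c) fu.
Qed.

(** Obtained from tameness of [f], at a level below its range. *)
Lemma finite_euler_set0 : finite_euler R (set0 : set X).
Proof.
have [_ _ _ /(_ (- M - 1))[fu _]] := f_tame.
by rewrite -(@sublevel_low (- M - 1))// gtrDl ltrN10.
Qed.

Lemma finite_euler_fiber c : finite_euler R (fiber c).
Proof. by have := finite_euler_fiber_le c M; rewrite sublevel_high// setTI. Qed.

Lemma fiber_euler_le_low c u : u < - M -> e c u = 0.
Proof.
move=> uM; rewrite /fiber_euler_le sublevel_low// set0I euler_set0//.
exact: finite_euler_set0.
Qed.

Lemma fiber_euler_le_high c u : M <= u -> e c u = chi c.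
Proof. by move=> uM; rewrite /fiber_euler_le sublevel_high// setTI. Qed.

(** The homotopy type of a single piece is not controlled, but its total Betti number is at most
    that of the whole sublevel set, which takes boundedly many values. *)
Lemma fiber_euler_le_bounded : exists2 B, 0 <= B & forall c u, `|e c u| <= B.
Proof.
have [_ [t ft] _ fu] := f_tame.
have [B fB] : exists B, forall u, (total_betti R (sublevel f u) <= B)%N.
  apply: (@constant_off_bounded _ t) => u v uv tuv.
  exact/homotopy_equivalent_total_betti/ft.
exists B%:R => // c u; rewrite /fiber_euler_le -intr_norm [leRHS]pmulrn ler_int.
have [fc _ _ le] := euler_split (h_clopen c) (fu u).1.
rewrite (le_trans (euler_le_total_betti fc))// lez_nat.
exact: leq_trans le (fB u).
Qed.

Lemma fibers_sum (A : set X) :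
  (forall c, finite_euler R (A `&` fiber c)) ->
  (euler R A)%:~R = \sum_(c <- s) (euler R (A `&` fiber c))%:~R :> R.
Proof.
move=> Ac; have As : A `<=` [set x | h x \in s] by move=> x _; exact: hs.
have [_ ->] := euler_fibers h_clopen finite_euler_set0 s_uniq As Ac.
by rewrite rmorph_sum.
Qed.

Lemma euler_le_sum u : (euler_le f u)%:~R = \sum_(c <- s) e c u.
Proof. by apply: fibers_sum => c; exact: finite_euler_fiber_le. Qed.

Lemma sublevelD_fiber c u :
  sublevel (fun x => h x + f x) u `&` fiber c = sublevel f (u - c) `&` fiber c.
Proof.
by apply/seteqP; split=> x; rewrite /sublevel /preimage /= => -[+ hx];
  rewrite hx lerBrDl.
Qed.

Lemma euler_leD_sum u :
  (euler_le (fun x => h x + f x) u)%:~R = \sum_(c <- s) e c (u - c).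
Proof.
rewrite fibers_sum => [|c].
  by apply: eq_bigr => c _; rewrite sublevelD_fiber.
by rewrite sublevelD_fiber; exact: finite_euler_fiber_le.
Qed.

Lemma sublevel_fiber c u :
  sublevel h u `&` fiber c = if c <= u then fiber c else set0.
Proof.
case: ifPn => cu; apply/seteqP; split=> x; rewrite /sublevel /preimage //=.
- by case.
- by move=> hx; rewrite hx.
- by move=> [+ hx]; rewrite hx (negbTE cu).
Qed.

Lemma euler_le_level_sum u :
  (euler_le h u)%:~R = \sum_(c <- s) chi c * unit_step c u.
Proof.
rewrite fibers_sum => [|c].
  apply: eq_bigr => c _; rewrite sublevel_fiber /unit_step.
  by case: ifP => _; rewrite ?mulr1// mulr0 euler_set0//; exact: finite_euler_set0.
rewrite sublevel_fiber; case: ifP => _; first exact: finite_euler_fiber.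
exact: finite_euler_set0.
Qed.

Lemma euler_sum_fibers : (euler R X)%:~R = \sum_(c <- s) chi c.
Proof.
rewrite (homotopy_equivalent_euler (homotopy_equivalent_setT R X)) fibers_sum.
  by apply: eq_bigr => c _; rewrite setTI.
by move=> c; rewrite setTI; exact: finite_euler_fiber.
Qed.

(** [e c] and the step agree outside [[- M, M]]. Translating by [c] moves the jump to [c], where the
    integrand of [h] has it. *)
Definition fiber_defect c u : R := e c u - chi c * unit_step 0 u.
Local Notation g := fiber_defect.

Lemma fiber_defect_dominated c : dominated (g c).
Proof.
have [B B0 eB] := fiber_euler_le_bounded.
apply: (@dominated_compact _ _ M (B + B)); first exact: addr_ge0.
  move=> u; rewrite (le_trans (ler_normB _ _))// lerD// normrM.
  have chiB : `|chi c| <= B by rewrite -(@fiber_euler_le_high c M).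
  rewrite -[leRHS]mulr1 ler_pM// /unit_step.
  by case: (0 <= u); rewrite ?normr1 ?normr0.
move=> u; rewrite /fiber_defect /unit_step lter_normr => /orP[Mu|Mu].
  by rewrite fiber_euler_le_high ?(ltW Mu)// (le_trans M_ge0) ?mulr1 ?subrr// ltW.
rewrite fiber_euler_le_low; last by rewrite ltrNr.
have -> : (0 <= u) = false.
  by apply/negbTE; rewrite -ltNge -oppr_gt0; exact: le_lt_trans M_ge0 Mu.
by rewrite /= mulr0 subr0.
Qed.

(** The integrand of the constant function [c] on a space of Euler characteristic one. *)
Definition level_kernel c u : R := 1 - unit_step c u - unit_step c (- u).
Local Notation T := level_kernel.

Lemma level_kernel_dominated c : dominated (T c).
Proof.
apply: (@dominated_compact _ _ `|c| 1) => // u.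
  by rewrite /level_kernel /unit_step; rewrite ler_norml;
     case: (c <= u); case: (c <= - u) => /=; lra.
have := ler_norm c; have := ler_norm (- c); rewrite normrN => c1 c2.
rewrite /level_kernel /unit_step lter_normr => /orP[cu|cu].
  have -> : c <= u by lra.
  have -> : (c <= - u) = false by apply/negbTE; rewrite -ltNge; lra.
  by rewrite subr0 subrr.
have -> : c <= - u by lra.
have -> : (c <= u) = false by apply/negbTE; rewrite -ltNge; lra.
by rewrite subr0 subrr.
Qed.

Lemma integrandD_sum u : upper_euler_integrand (fun x => h x + f x) u =
  \sum_(c <- s) (chi c * T c u + -1 * (g c (u - c) + g c (- u - c))).
Proof.
rewrite /upper_euler_integrand /euler_gt !rmorphB/= euler_sum_fibers !euler_leD_sum.
rewrite -!sumrB; apply: eq_bigr => c _; rewrite /fiber_defect /level_kernel /unit_step.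
by rewrite !subr_ge0; ring.
Qed.

Lemma integrand_level_sum u :
  upper_euler_integrand h u = \sum_(c <- s) chi c * T c u.
Proof.
rewrite /upper_euler_integrand /euler_gt !rmorphB/= euler_sum_fibers.
rewrite !euler_le_level_sum.
by rewrite -!sumrB; apply: eq_bigr => c _; rewrite /level_kernel; ring.
Qed.

Lemma integrand_sum u : upper_euler_integrand f u =
  \sum_(c <- s) (chi c * T 0 u + -1 * (g c u + g c (- u))).
Proof.
rewrite /upper_euler_integrand /euler_gt !rmorphB/= euler_sum_fibers !euler_le_sum.
by rewrite -!sumrB; apply: eq_bigr => c _; rewrite /fiber_defect /level_kernel; ring.
Qed.

Local Notation mu := (@lebesgue_measure R).

Lemma integrands_dominated : [/\
  dominated (upper_euler_integrand (fun x => h x + f x)),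
  dominated (upper_euler_integrand h) & dominated (upper_euler_integrand f)].
Proof.
split.
- rewrite (funext integrandD_sum); apply: dominated_sum => c.
  apply: dominatedD; first exact/dominatedZ/level_kernel_dominated.
  apply/dominatedZ/dominatedD; first exact/dominated_shift/fiber_defect_dominated.
  apply: (dominated_opp (f := fun u => g c (u - c))).
  exact/dominated_shift/fiber_defect_dominated.
- rewrite (funext integrand_level_sum); apply: dominated_sum => c.
  exact/dominatedZ/level_kernel_dominated.
- rewrite (funext integrand_sum); apply: dominated_sum => c.
  apply: dominatedD; first exact/dominatedZ/level_kernel_dominated.
  apply/dominatedZ/dominatedD; first exact: fiber_defect_dominated.
  exact/dominated_opp/fiber_defect_dominated.
Qed.

(* The flag [false] stands for a reflected defect, on which [c] acts by the
   opposite translation. *)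
Definition signed_levels : seq (bool * R) :=
  [seq (true, c) | c <- s] ++ [seq (false, c) | c <- s].

Definition signed_shift (i : bool * R) : R := if i.1 then i.2 else - i.2.

Definition signed_defect (i : bool * R) u : R :=
  -1 * (if i.1 then g i.2 u else g i.2 (- u)).

(* The error term comes from the kernel [T 0], which vanishes off [0]. *)
Lemma integrands_coboundary u :
  upper_euler_integrand (fun x => h x + f x) u - upper_euler_integrand h u
    - upper_euler_integrand f u
    - \sum_(i <- signed_levels)
        (signed_defect i (u - signed_shift i) - signed_defect i u) =
  (\sum_(c <- s) chi c) * \1_[set 0] u.
Proof.
rewrite integrandD_sum integrand_level_sum integrand_sum.
rewrite big_cat !big_map/= mulr_suml -!sumrB -big_split -sumrB.
apply: eq_bigr => c _; rewrite /signed_defect /signed_shift/= opprK [- (u + c)]opprD.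
have -> : T 0 u = - \1_[set 0] u.
  rewrite indicE /level_kernel /unit_step.
  have -> : (u \in [set 0]) = (u == 0).
    by apply/idP/eqP => [/set_mem|->]; [|exact/mem_set].
  rewrite oppr_ge0; case: (ltgtP u 0) => [_|_|_] /=; lra.
by ring.
Qed.

(** The difference of the integrands is a sum of coboundaries up to an error supported at the
    origin, so its integral is bounded by that of the error, which is zero. *)
Lemma integral_integrands :
  integrable_line (upper_euler_integrand (fun x => h x + f x)) ->
  integrable_line (upper_euler_integrand h) ->
  integrable_line (upper_euler_integrand f) ->
  \int[mu]_u upper_euler_integrand (fun x => h x + f x) u =
  \int[mu]_u upper_euler_integrand h u + \int[mu]_u upper_euler_integrand f u.
Proof.
move=> hfi hi fi; have hfhi := integrable_lineB hfi hi.
apply/eqP; rewrite -subr_eq0 opprD addrA -!RintegralB// -normr_le0.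
have [ri rE] := indicator0_integral `|\sum_(c <- s) chi c|.
rewrite -rE.
apply: (coboundary_integral_le (s := signed_levels) (a := signed_shift)
  (g := signed_defect) _ (integrable_lineB hfhi fi) ri); last first.
  by move=> u; rewrite integrands_coboundary normrM [`|\1__ u|]ger0_norm.
move=> [b c]; apply: dominatedZ; case: b => /=; first exact: fiber_defect_dominated.
exact/dominated_opp/fiber_defect_dominated.
Qed.

End finitely_many_levels.

Lemma upper_euler_integral_line (R : realType) (X : topologicalType) (f : X -> R) :
  integrable_line (upper_euler_integrand f) ->
  upper_euler_integral f =
  (2^-1 * \int[@lebesgue_measure R]_u upper_euler_integrand f u)%:E.
Proof.
move=> fi; rewrite even_integral//; last exact: upper_euler_integrand_even.
rewrite mulrA mulVf ?pnatr_eq0// mul1r /Rintegral fineK//.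
apply: integrable_fin_num => //; exact: integrableS fi.
Qed.

(* Tameness of [h] and [f] implies neither that of [h + f] nor measurability of
   its integrand; [hf_measurable] says that the integral on the left is
   defined. *)
Theorem proposition7p2 (R : realType) (X : topologicalType)
    (X_compact : compact [set: X]) (X_euler : finite_euler R X)
    (h f : X -> R) (h_tame : tame h) (f_tame : tame f)
    (h_discrete : isolated (range h) = range h)
    (hf_measurable :
      measurable_fun (`[0, +oo[%classic : set R)
        (upper_euler_integrand (fun x => h x + f x))) :
  upper_euler_integral (fun x => h x + f x) =
  (upper_euler_integral h + upper_euler_integral f)%E.
Proof.
have [h_cont _ _ _] := h_tame; have [f_cont _ _ _] := f_tame.
have [s s_uniq hs] := range_finite X_compact h_cont h_discrete.
have [M M0 fM] := range_bounded X_compact f_cont.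
have hc c := @fiber_clopen _ _ h c h_cont h_discrete.
have [hfd hd fd] := integrands_dominated f_tame hc s_uniq hs M0 fM.
(* Evenness carries the measurability hypothesis from the half-line to the line. *)
have hfi := dominated_integrable hfd
  (even_measurable (upper_euler_integrand_even _) hf_measurable).
have hi := dominated_integrable hd (tame_integrand_measurable h_tame).
have fi := dominated_integrable fd (tame_integrand_measurable f_tame).
rewrite !upper_euler_integral_line//.
by rewrite (integral_integrands f_tame hc s_uniq hs M0 fM)// mulrDr.
Qed.
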